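(* Let $T\in\mathbf N$ and let $\widetilde{\mathbf P}$ be a probability measure equivalent to $\mathbf P$ on $\mathcal F_T$. Then there exist $\tilde\lambda\in(0,1)$ and a probability measure $\widetilde{\mathbf Q}$ on $E$ such that under $\widetilde{\mathbf P}$ the marked binomial process has compensator (intensity) $\tilde\lambda\,\#\otimes\widetilde{\mathbf Q}$, where $\#$ is the counting measure on times. Moreover, for any $t\in\{1,\dots,T\}$, $$\frac{d\widetilde{\mathbf P}}{d\mathbf P}\Big|_{\mathcal F_t}=\xi_t(h),$$ where $h$ is the element of $L^2(\mathbb X)$ such that $J_1(h)=J_1(g;\mathcal Z)$ with $$g(t,k)=\frac{\tilde\lambda\,\widetilde{\mathbf Q}(\{k\})}{\lambda\,\mathbf Q(\{k\})}-\frac{1-\tilde\lambda}{1-\lambda}$$ for all $(t,k)\in\{1,\dots,T\}\times E$ (and $g(t,k)=0$ for $t>T$).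
   Context: Notation: $\mathbf N=\{1,2,\dots\}$. $E$ is a countable (possibly finite) subset of $\mathbf Z$, $\mathbb X=\mathbf N\times E$, $\lambda\in(0,1)$, and $\mathbf Q$ is a probability measure on $E$ with $\mathbf Q(\{k\})>0$ for all $k\in E$. The marked binomial process is the random measure $\eta=\sum_{i\ge 1}\delta_{(T_i,V_i)}$ on $\mathbb X$, where $T_i=\xi_1+\dots+\xi_i$ with $\xi_j$ i.i.d. geometric of parameter $\lambda$ (values in $\mathbf N$), and $(V_i)$ is i.i.d. with law $\mathbf Q$, independent of $(T_i)$. Equivalently, independently for each $t\in\mathbf N$, $\eta$ has no point at time $t$ with probability $1-\lambda$ and exactly one point $(t,k)$ with probability $\lambda\mathbf Q(\{k\})$. Its compensator (intensity) under $\mathbf P$ is $\nu=\lambda\,\#\otimes\mathbf Q$, i.e. $\nu(\{(t,k)\})=\lambda\mathbf Q(\{k\})$. Filtration: $\mathcal F_0$ trivial, $\mathcal F_t=\sigma\{\eta(\{(s,k)\}): s\le t,k\in E\}$. Increments: $\Delta Z_{(t,k)}=\mathbf 1_{\{(t,k)\in\eta\}}-\lambda\mathbf Q(\{k\})$. Enumerate $E=\{k^1,k^2,\dots\}$ and set $\Delta R_{(t,k^1)}=\Delta Z_{(t,k^1)}$, $\Delta R_{(t,k^n)}=\Delta Z_{(t,k^n)}-\sum_{j=1}^{n-1}\gamma_{nj}\Delta R_{(t,k^j)}$, with $\gamma_{nj}=\mathbf E[\Delta Z_{(1,k^n)}\Delta R_{(1,k^j)}]/\mathbf E[(\Delta R_{(1,k^j)})^2]$.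 $L^2(\mathbb X)=L^2(\mathbb X,\nu)$. Multiple integrals: $J_n(f_n)=n!\sum f_n((t_1,k_1),\dots,(t_n,k_n))\prod_{i=1}^n\Delta R_{(t_i,k_i)}$, the sum being over $n$-tuples in $\mathbb X^n$ with $t_1<\dots<t_n$, for symmetric square-integrable $f_n$; and $J_1(g;\mathcal Z)=\sum_{(t,k)\in\mathbb X}g(t,k)\Delta Z_{(t,k)}$. Doléans exponential: $\xi(h)=1+\sum_{n\ge1}\frac1{n!}J_n(h^{\otimes n})$ and $\xi_t(h)=\xi(h\mathbf 1_{\{1,\dots,t\}\times E})$.
   Formalization: Added: under the equivalent measure the contents of times 1,…,T are i.i.d. (otherwise the compensator need not be homogeneous); and, for the density formula, g is in L²(X) (automatic for finite E, otherwise h need not exist). *)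

(* Defs.v *)
From HB Require Import structures.
From mathcomp Require Import all_boot all_order all_algebra finmap.
From mathcomp Require Import all_classical all_reals all_analysis.

Set Implicit Arguments.
Unset Strict Implicit.
Unset Printing Implicit Defensive.

Import Order.TTheory GRing.Theory Num.Theory.
Import numFieldNormedType.Exports.

Local Open Scope classical_set_scope.
Local Open Scope ring_scope.

(* The library makes nat, bool and unit discrete measurable types, but not
   int. *)
HB.instance Definition _ := isPointed.Build int 0.

HB.instance Definition _ := @isMeasurable.Build default_measure_display
  int discrete_measurable discrete_measurable0
  discrete_measurableC discrete_measurableU.

Section L2_summation.
Context {d : measure_display} {Omega : measurableType d} {R : realType}.
Variable P : probability Omega R.

(* Unconditional convergence in L^2(P): X is the limit of the sums of u over
   the net of finite subsets of D. *)
Definition is_L2sum (K : choiceType) (D : set K) (u : K -> Omega -> R)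
    (X : Omega -> R) : Prop :=
  measurable_fun [set: Omega] X /\
  forall eps : R, 0 < eps ->
    exists2 A : {fset K}, [set` A] `<=` D &
      forall B : {fset K}, (A `<=` B)%fset -> [set` B] `<=` D ->
        (\int[P]_w (((X w - \sum_(i <- B) u i w) ^+ 2)%:E) < eps%:E)%E.

(* The limit is unique up to P-almost sure equality; [L2sum] selects one
   version, and is 0 when the family is not summable. *)
Definition L2sum (K : choiceType) (D : set K) (u : K -> Omega -> R)
  : Omega -> R := xget (fun=> 0) [set X | is_L2sum D u X].

End L2_summation.

(* nu({(t, k)}) for nu = lam * (counting measure on times) (x) Q *)
Definition intensity {R : realType} (lam : R) (Q : probability int R)
  (t : nat) (k : int) : R := lam * fine (Q [set k]).

(* Times are natural numbers and the space N x E of the text is the set of the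
   pairs (t, k) with 0 < t and k in E. *)
Definition space (E : set int) : set (nat * int) :=
  [set x | (0 < x.1)%N /\ E x.2].

(* Membership in L^2(N x E, intensity lam Q); values outside N x E are
   irrelevant. *)
Definition inL2 {R : realType} (lam : R) (Q : probability int R) (E : set int)
    (f : nat -> int -> R) : Prop :=
  (\esum_(x in space E) ((f x.1 x.2) ^+ 2 * intensity lam Q x.1 x.2)%:E
    < +oo)%E.

Section point_process.
Context {Omega : Type}.
Variables (E : set int) (gap : nat -> Omega -> nat) (V : nat -> Omega -> int).

(* gap i and V i are the (i+1)-st interarrival time and mark. *)
Definition arrival (i : nat) (w : Omega) : nat := (\sum_(j < i.+1) gap j w)%N.

Definition eta (w : Omega) : set (nat * int) :=
  [set x | exists i, arrival i w = x.1 /\ V i w = x.2].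

Definition point (t : nat) (k : int) : set Omega := [set w | eta w (t, k)].

Definition slot (t : nat) (o : option int) : set Omega :=
  if o is Some k then point t k else [set w | forall k, ~ eta w (t, k)].

Definition history (t : nat) : set (set Omega) :=
  [set A | exists s k, [/\ (0 < s <= t)%N, E k & A = point s k]].

(* The sigma-algebra F_t is <<s history t >>, the family of the measurable sets
   of [filt t]. *)
Definition filt (t : nat) := g_sigma_algebraType (history t).

End point_process.

Section laws.
Context {d : measure_display} {Omega : measurableType d} {R : realType}.
Variables (P : probability Omega R) (lam : R) (E : set int)
  (Q : probability int R).
Variables (gap : nat -> {RV P >-> nat}) (V : nat -> {RV P >-> int}).

Record marked_binomial : Prop := MarkedBinomial {
  gap_gt0 : forall i w, (0 < gap i w)%N ;
  mark_in : forall i w, E (V i w) ;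
  gap_law : forall i n,
    P (gap i @^-1` [set n.+1]) = (lam * (1 - lam) ^+ n)%:E ;
  mark_law : forall i B, P (V i @^-1` B) = Q B ;
  (* mutual independence of the whole family gap_0, V_0, gap_1, V_1, ... *)
  mutual_indep : forall n (A : nat -> set nat) (B : nat -> set int),
    fine (P (\bigcap_(i in `I_n) (gap i @^-1` A i `&` V i @^-1` B i))) =
    \prod_(i < n) (fine (P (gap i @^-1` A i)) * fine (P (V i @^-1` B i))) }.

End laws.

Section change_of_measure.
Context {Omega : pointedType} {R : realType}.
Variables (E : set int) (gap : nat -> Omega -> nat) (V : nat -> Omega -> int).

(* Over the times 1, ..., T, the process is a marked binomial process under Pt,
   with unspecified parameters: the time slots are i.i.d., a slot being either
   empty (None) or occupied by one point of mark k (Some k). Equivalence to P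
   alone does not give this: a product law whose occupation probability varies
   with t is also equivalent to P, and its compensator is not homogeneous. *)
Definition iid_slots (T : nat)
    (Pt : probability (filt E gap V T) R) : Prop :=
  (forall t o, (0 < t <= T)%N ->
     Pt (slot gap V t o) = Pt (slot gap V 1%N o)) /\
  (forall o : nat -> option int,
     fine (Pt (\bigcap_(t in [set t | (0 < t <= T)%N]) slot gap V t (o t))) =
     \prod_(1 <= t < T.+1) fine (Pt (slot gap V t (o t)))).

(* The deterministic measure nu is the compensator of the process under Pt up
   to time T: Pt((t, k) in eta | F_(t-1)) = nu({(t, k)}) almost surely, with
   conditional expectation unfolded. *)
Definition is_compensator (T : nat) (Pt : probability (filt E gap V T) R)
    (nu : nat -> int -> R) : Prop :=
  forall t k A, (0 < t <= T)%N -> E k -> <<s history E gap V t.-1 >> A ->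
    Pt (point gap V t k `&` A) = ((nu t k)%:E * Pt A)%E.

End change_of_measure.

Section equivalence_density.
Context {d : measure_display} {Omega : measurableType d} {R : realType}.
Variables (P : probability Omega R) (E : set int).
Variables (gap : nat -> Omega -> nat) (V : nat -> Omega -> int).

Definition equivalent_on (T : nat) (Pt : probability (filt E gap V T) R)
  : Prop :=
  forall A, <<s history E gap V T >> A -> P A = 0%E <-> Pt A = 0%E.

(* L is (a version of) the density dPt/dP on F_t. *)
Definition is_density (T : nat) (Pt : probability (filt E gap V T) R) (t : nat)
    (L : Omega -> R) : Prop :=
  exists D : filt E gap V t -> R,
    [/\ measurable_fun [set: filt E gap V t] D,
        forall w, 0 <= D w,
        {ae P, forall w, L w = D w} &
        forall A, <<s history E gap V t >> A ->
          Pt A = (\int[P]_(w in A) (D w)%:E)%E].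

End equivalence_density.

Section chaos.
Context {d : measure_display} {Omega : measurableType d} {R : realType}.
Variables (P : probability Omega R) (lam : R) (E : set int)
  (Q : probability int R).
Variables (gap : nat -> Omega -> nat) (V : nat -> Omega -> int).

(* The enumeration k^1, k^2, ... of E: a bijection e from I onto E, where I is
   an initial segment of nat (all of nat when E is infinite); k^n is e n.-1. *)
Definition enumerates (I : set nat) (e : nat -> int) : Prop :=
  (forall m n, (m < n)%N -> I n -> I m) /\ set_bij I E e.

Variables (I : set nat) (e : nat -> int).

Definition dZ (t : nat) (k : int) (w : Omega) : R :=
  \1_(point gap V t k) w - intensity lam Q t k.

Definition gamma (k : int) (f : nat -> Omega -> R) : R :=
  fine ('E_P[fun w => dZ 1%N k w * f 1%N w]) / fine ('E_P[fun w => f 1%N w ^+ 2]).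

Fixpoint dR_seq (n : nat) : seq (nat -> Omega -> R) :=
  if n is m.+1 then
    rcons (dR_seq m) (fun t w =>
      dZ t (e m) w - \sum_(f <- dR_seq m) gamma (e m) f * f t w)
  else [::].

(* dR t n is the increment of R at the point (t, e n). *)
Definition dR (t n : nat) : Omega -> R :=
  nth (fun _ _ => 0) (dR_seq n.+1) n t.

(* Tuples ((t_1, j_1), ..., (t_n, j_n)) with 0 < t_1 < ... < t_n, standing for
   the points (t_i, e j_i). *)
Definition increasing (n : nat) : set (n.-tuple (nat * nat)) :=
  [set s : n.-tuple (nat * nat) |
    sorted ltn (unzip1 s) /\ forall p, p \in s -> (0 < p.1)%N /\ I p.2].

Definition J (n : nat) (f : n.-tuple (nat * int) -> R) (w : Omega) : R :=
  n`!%:R * L2sum P (@increasing n)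
    (fun s w' => f (map_tuple (fun p : nat * nat => (p.1, e p.2)) s) *
                 \prod_(p <- s) dR p.1 p.2 w') w.

Definition J1Z (g : nat -> int -> R) : Omega -> R :=
  L2sum P (space E) (fun x w => g x.1 x.2 * dZ x.1 x.2 w).

Definition tens (h : nat -> int -> R) (n : nat) (s : n.-tuple (nat * int)) : R :=
  \prod_(x <- s) h x.1 x.2.

Definition doleans (h : nat -> int -> R) (w : Omega) : R :=
  1 + L2sum P [set n | (0 < n)%N]
        (fun n w' => n`!%:R^-1 * J (@tens h n) w') w.

Definition doleans_upto (t : nat) (h : nat -> int -> R) : Omega -> R :=
  doleans (fun s k => if (s <= t)%N then h s k else 0).

End chaos.

(* This kernel is in L^2(N x E, intensity lam Q) when E is finite, but not
   always when E is infinite (Q k = 2^-k and Qt k proportional to k^-2). *)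
Definition girsanov_kernel {R : realType} (T : nat) (lam : R)
    (Q : probability int R) (lamt : R) (Qt : probability int R)
    (t : nat) (k : int) : R :=
  if (t <= T)%N then
    lamt * fine (Qt [set k]) / (lam * fine (Q [set k]))
    - (1 - lamt) / (1 - lam)
  else 0.

(* Main.v *)
(* Let X_t be the content of the time slot t: empty, or the mark of its point.
   Since the geometric law has no memory, the X_t are i.i.d. under P, and every
   event of F_t is a countable union of atoms {X_1 = o_1, ..., X_t = o_t}. Under
   Pt the X_t are i.i.d. as well, so that the density of Pt on F_t is the product
   of the L(X_s), s <= t, where L is the ratio of the two laws of a slot.

   The Gram-Schmidt procedure is explicit: if p_n = P(X_t = k^n) and
   rho_n = 1 - p_1 - ... - p_(n-1), then
     Delta R_(t,k^n) = 1_{X_t = k^n} - (p_n / rho_n) 1_{X_t not in {k^1, ..., k^(n-1)}}.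
   These functions are orthogonal and, together with the constants, total in the
   L^2 space of a slot. The function G = L - 1 is centered and is the sum of the
   g(t, k) Delta Z_(t,k); its coefficients on the Delta R_(t,k^n) define h. By
   independence and Parseval, J_n(h^(x)n) / n! is the n-th elementary symmetric
   function of G(X_1), ..., G(X_t), and the Doleans exponential is the product of
   the 1 + G(X_s) = L(X_s).

   Uniqueness of h is obtained by pairing with a Delta R_(t,k). As J_1 is 0 by
   convention on non-summable families, this requires that J_1(h') be summable
   for every h' in L^2, which rests on the completeness of L^2. *)
Require Import Defs.
From mathcomp Require Import all_boot all_order all_algebra finmap.
From mathcomp Require Import all_classical all_reals all_analysis.
From mathcomp Require Import measurable_realfun ring lra.

Set Implicit Arguments.
Unset Strict Implicit.
Unset Printing Implicit Defensive.

Import Order.TTheory GRing.Theory Num.Theory.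
Import numFieldNormedType.Exports.

Local Open Scope classical_set_scope.
Local Open Scope ring_scope.

(** * Square-integrable functions *)

(** [J], [J1Z] and [doleans] are chosen limits, 0 on non-summable families, so they cannot be
    computed directly: a candidate limit is exhibited, summability is proved, and almost sure
    uniqueness transfers the formula. For infinite [E] the families are infinite even at one time,
    and convergence comes from norms alone: for orthogonal terms with the right pairings it suffices
    that a finite set of them carries nearly the whole norm of the candidate. In degree [n] this
    norm is a polynomial in the second moment of [G], and the terms with marks among the first [N]
    add up to the same polynomial at the [N]-th Bessel sum of one slot. Everything thus reduces to
    Parseval on a single slot. There the empty slot is never resolved by Gram-Schmidt: the mass left
    after any number of marks is at least [1 - lam]. This keeps denominators away from 0 and makes
    the variance of an increment comparable to its intensity, which links [inL2] to the convergence
    of [J] in degree 1. The [dZ] at one time are correlated, so [J1Z] needs a direct estimate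
    instead. Summability of [g] is what makes the likelihood ratio square integrable. *)

Section square_integrable.
Context {d : measure_display} {Omega : measurableType d} {R : realType}.
Variable P : probability Omega R.
Implicit Types (f g X Y : Omega -> R).

(** A real number, so that field tactics apply; [fine] sends an infinite integral to 0, hence the
    [L1] hypotheses of the algebraic rules. *)
Definition mean f : R := fine (\int[P]_w (f w)%:E)%E.

Definition L1 f : Prop := P.-integrable [set: Omega] (EFin \o f).

Definition L2 f : Prop :=
  measurable_fun [set: Omega] f /\ L1 (fun w => f w ^+ 2).

Lemma L1_le f g : measurable_fun [set: Omega] f ->
  (forall w, `|f w| <= g w) -> L1 g -> L1 f.
Proof.
move=> mf fg gi; apply: le_integrable gi => //; first exact/measurable_EFinP.
by move=> w _ /=; rewrite lee_fin (le_trans (fg w))// ler_norm.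
Qed.

Lemma integral_mean f : L1 f -> (\int[P]_w (f w)%:E)%E = (mean f)%:E.
Proof. by move=> fi; rewrite /mean fineK// integrable_fin_num. Qed.

Lemma L1_cst c : L1 (fun=> c).
Proof. exact: finite_measure_integrable_cst. Qed.

Lemma L1D f g : L1 f -> L1 g -> L1 (fun w => f w + g w).
Proof.
by move=> fi gi; apply: eq_integrable (integrableD _ fi gi).
Qed.

Lemma L1Z c f : L1 f -> L1 (fun w => c * f w).
Proof. by move=> fi; apply: eq_integrable (integrableZl _ c fi). Qed.

Lemma meanD f g : L1 f -> L1 g -> mean (fun w => f w + g w) = mean f + mean g.
Proof.
move=> fi gi; apply: EFin_inj; rewrite EFinD -!integral_mean//; last exact: L1D.
by rewrite -integralD_EFin.
Qed.

Lemma meanZ c f : L1 f -> mean (fun w => c * f w) = c * mean f.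
Proof.
move=> fi; apply: EFin_inj; rewrite EFinM -!integral_mean//; last exact: L1Z.
by rewrite -integralZl.
Qed.

Lemma L1N f : L1 f -> L1 (fun w => - f w).
Proof.
move=> /(L1Z (-1)); rewrite (_ : (fun w => -1 * f w) = fun w => - f w)//.
by apply/funext => w; rewrite mulN1r.
Qed.

Lemma meanN f : L1 f -> mean (fun w => - f w) = - mean f.
Proof.
move=> fi; rewrite -mulN1r -meanZ//; congr mean.
by apply/funext => w; rewrite mulN1r.
Qed.

Lemma L1B f g : L1 f -> L1 g -> L1 (fun w => f w - g w).
Proof. by move=> fi gi; apply: L1D => //; exact: L1N. Qed.

Lemma meanB f g : L1 f -> L1 g -> mean (fun w => f w - g w) = mean f - mean g.
Proof. by move=> fi gi; rewrite meanD ?meanN//; exact: L1N. Qed.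

Lemma mean_cst c : mean (fun=> c) = c.
Proof.
rewrite /mean integral_cst// [X in (_ * X)%E](_ : _ = 1%E) ?mule1//.
exact: probability_setT.
Qed.

Lemma mean_ge0 f : (forall w, 0 <= f w) -> 0 <= mean f.
Proof. by move=> f0; apply/fine_ge0/integral_ge0 => w _; rewrite lee_fin. Qed.

Lemma mean_le f g : L1 f -> L1 g -> (forall w, f w <= g w) -> mean f <= mean g.
Proof.
move=> fi gi fg; rewrite -subr_ge0 -meanB//; apply: mean_ge0 => w.
by rewrite subr_ge0.
Qed.

Lemma L1_sum (K : eqType) (s : seq K) (u : K -> Omega -> R) :
  {in s, forall i, L1 (u i)} -> L1 (fun w => \sum_(i <- s) u i w).
Proof.
elim: s => [_|i s IH ui].
  by rewrite [F in L1 F](_ : _ = fun=> 0);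
    [exact: L1_cst|apply/funext => w; rewrite big_nil].
rewrite [F in L1 F](_ : _ = fun w => u i w + \sum_(j <- s) u j w).
  apply: L1D; first exact/ui/mem_head.
  by apply: IH => j js; apply: ui; rewrite in_cons js orbT.
by apply/funext => w; rewrite big_cons.
Qed.

Lemma mean_sum (K : eqType) (s : seq K) (u : K -> Omega -> R) :
  {in s, forall i, L1 (u i)} ->
  mean (fun w => \sum_(i <- s) u i w) = \sum_(i <- s) mean (u i).
Proof.
elim: s => [_|i s IH ui].
  rewrite big_nil -[RHS](mean_cst 0); congr mean.
  by apply/funext => w; rewrite big_nil.
have us : {in s, forall j, L1 (u j)}.
  by move=> j js; apply: ui; rewrite in_cons js orbT.
rewrite big_cons -IH// -meanD; [|exact/ui/mem_head|exact: L1_sum].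
by congr mean; apply/funext => w; rewrite big_cons.
Qed.

Lemma L2_bounded c f : measurable_fun [set: Omega] f ->
  (forall w, `|f w| <= c) -> L2 f.
Proof.
move=> mf fc; split=> //.
apply: (@L1_le _ (fun=> c ^+ 2)); last exact: L1_cst.
  exact: measurable_funX.
move=> w; rewrite normrX ler_pXn2r// nnegrE//.
by rewrite (le_trans _ (fc w)).
Qed.

Lemma L2M f g : L2 f -> L2 g -> L1 (fun w => f w * g w).
Proof.
move=> [mf fi] [mg gi].
apply: (@L1_le _ (fun w => f w ^+ 2 + g w ^+ 2)); last exact: L1D.
  exact: measurable_funM.
move=> w; rewrite normrM -[f w ^+ 2]real_normK ?num_real//.
rewrite -[g w ^+ 2]real_normK ?num_real//.
have := sqr_ge0 (`|f w| - `|g w|).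
have : 0 <= `|f w| * `|g w| by rewrite mulr_ge0.
nra.
Qed.

Lemma L2_cst c : L2 (fun=> c).
Proof. by split; [exact: measurable_cst|exact: L1_cst]. Qed.

Lemma L2_L1 f : L2 f -> L1 f.
Proof.
move=> /L2M /(_ (L2_cst 1)).
by rewrite (_ : (fun w => _ * _) = f)//; apply/funext => w; rewrite mulr1.
Qed.

Lemma L2D f g : L2 f -> L2 g -> L2 (fun w => f w + g w).
Proof.
move=> f2 g2; split; first by apply: measurable_funD; [case: f2|case: g2].
rewrite (_ : (fun w => _) =
  (fun w => (f w ^+ 2 + 2 * (f w * g w)) + g w ^+ 2)); last first.
  by apply/funext => w; ring.
apply: L1D; last by case: g2.
by apply: L1D; [case: f2|exact/L1Z/L2M].
Qed.

Lemma L2Z c f : L2 f -> L2 (fun w => c * f w).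
Proof.
move=> [mf fi]; split; first exact: measurable_funM.
rewrite (_ : (fun w => _) = (fun w => c ^+ 2 * f w ^+ 2)); first exact: L1Z.
by apply/funext => w; rewrite exprMn.
Qed.

Lemma L2N f : L2 f -> L2 (fun w => - f w).
Proof.
move=> /(L2Z (-1)); rewrite (_ : (fun w => -1 * f w) = fun w => - f w)//.
by apply/funext => w; rewrite mulN1r.
Qed.

Lemma L2B f g : L2 f -> L2 g -> L2 (fun w => f w - g w).
Proof. by move=> f2 g2; apply: L2D => //; exact: L2N. Qed.

Lemma L2_sum (K : eqType) (s : seq K) (u : K -> Omega -> R) :
  {in s, forall i, L2 (u i)} -> L2 (fun w => \sum_(i <- s) u i w).
Proof.
elim: s => [_|i s IH ui].
  by rewrite [F in L2 F](_ : _ = fun=> 0);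
    [exact: L2_cst|apply/funext => w; rewrite big_nil].
rewrite [F in L2 F](_ : _ = fun w => u i w + \sum_(j <- s) u j w).
  apply: L2D; first exact/ui/mem_head.
  by apply: IH => j js; apply: ui; rewrite in_cons js orbT.
by apply/funext => w; rewrite big_cons.
Qed.

Lemma mean_ae f g : measurable_fun [set: Omega] f ->
  measurable_fun [set: Omega] g ->
  {ae P, forall w, f w = g w} -> mean f = mean g.
Proof.
move=> mf mg fg; congr fine; apply: ae_eq_integral => //.
- exact/measurable_EFinP.
- exact/measurable_EFinP.
- by apply: filterS fg => w /= -> _.
Qed.

Lemma mean_sqr_eq0 f : L2 f -> mean (fun w => f w ^+ 2) = 0 ->
  {ae P, forall w, f w = 0}.
Proof.
move=> [mf fi] f0.
have mf2 : measurable_fun [set: Omega] (EFin \o (fun w => f w ^+ 2)).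
  by apply/measurable_EFinP; exact: measurable_funX.
have := (ae_eq_integral_abs P measurableT mf2).1.
move=> /(_ _)[|B [mB PB AB]].
  transitivity (\int[P]_w (f w ^+ 2)%:E)%E.
    by apply: eq_integral => w _ /=; rewrite ger0_norm// sqr_ge0.
  by rewrite integral_mean// f0.
exists B; split => // w /= fw; apply: AB => /= /(_ Logic.I)[].
by move/eqP; rewrite sqrf_eq0 => /eqP.
Qed.

(** Young's inequality with a free weight [c]; it serves as Cauchy-Schwarz without square roots. *)
Lemma mean_mul_le f g : L2 f -> L2 g -> forall c, 0 < c ->
  2 * `|mean (fun w => f w * g w)| <=
  c^-1 * mean (fun w => f w ^+ 2) + c * mean (fun w => g w ^+ 2).
Proof.
move=> f2 g2 c c0.
have fg1 := L2M f2 g2; have f1 := f2.2; have g1 := g2.2.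
have bd w : 2 * `|f w * g w| <= c^-1 * f w ^+ 2 + c * g w ^+ 2.
  have -> : c^-1 * f w ^+ 2 + c * g w ^+ 2 =
    c^-1 * (`|f w| - c * `|g w|) ^+ 2 + 2 * `|f w * g w|.
    rewrite -[f w ^+ 2]real_normK ?num_real// -[g w ^+ 2]real_normK ?num_real//.
    by rewrite normrM; field; rewrite gt_eqF.
  by rewrite lerDr mulr_ge0// ?sqr_ge0// invr_ge0 ltW.
rewrite -!meanZ// -meanD; [|exact: L1Z|exact: L1Z].
have rhs1 : L1 (fun w => c^-1 * f w ^+ 2 + c * g w ^+ 2).
  by apply: L1D; exact: L1Z.
have [m0|/ltW m0] := leP 0 (mean (fun w => f w * g w)).
  rewrite ger0_norm// -meanZ//; apply: mean_le => //; first exact: L1Z.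
  by move=> w; apply: le_trans (bd w); rewrite ler_pM2l// ler_norm.
rewrite ler0_norm// -meanN// -meanZ; last exact: L1N.
apply: mean_le => //; first exact/L1Z/L1N.
by move=> w; apply: le_trans (bd w); rewrite ler_pM2l// ler_normr lexx orbT.
Qed.

End square_integrable.

(** * Unconditional sums in L^2 *)

Lemma sum_fsetD (V : nmodType) (K : choiceType) (A B : {fset K}) (F : K -> V) :
  (A `<=` B)%fset ->
  \sum_(i <- B) F i = \sum_(i <- A) F i + \sum_(i <- (B `\` A)%fset) F i.
Proof.
move=> AB; rewrite (big_fsetID _ (mem A))/=; congr (_ + _).
  by apply: eq_fbigl => i; rewrite !inE/= andbC; apply/andb_idr/(fsubsetP AB).
by apply: eq_fbigl => i; rewrite !inE/= andbC.
Qed.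

(** Riesz-Fischer for a fast Cauchy sequence: the rate makes the increments summable in mean, hence
    almost surely absolutely summable, and Fatou's lemma carries the Cauchy bound to the limit. *)
Lemma L2_complete d (Omega : measurableType d) (R : realType)
  (P : probability Omega R) (f : nat -> Omega -> R) :
  (forall n, L2 P (f n)) ->
  (forall n m, (n <= m)%N ->
     mean P (fun w => (f m w - f n w) ^+ 2) <= 4^-1 ^+ n) ->
  exists2 X, L2 P X & forall n, mean P (fun w => (X w - f n w) ^+ 2) <= 4^-1 ^+ n.
Proof.
move=> f2 fc.
pose D n w := `|f n.+1 w - f n w|.
have mf n : measurable_fun [set: Omega] (f n) by case: (f2 n).
have mD n : measurable_fun [set: Omega] (D n).
  by apply: measurableT_comp => //; exact: measurable_funB.
have D2 n : L2 P (D n).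
  split=> //; rewrite (_ : (fun w => _) = fun w => (f n.+1 w - f n w) ^+ 2).
    by have [] := L2B (f2 n.+1) (f2 n).
  by apply/funext => w; rewrite real_normK// num_real.
have D0 n w : 0 <= D n w by exact: normr_ge0.
have meanDle n : mean P (D n) <= 2^-1 ^+ n.
  (* With weight [c = 2^-n], Young's inequality against the constant 1 turns the bound [4^-n] on the
     mean of [D n ^+ 2] into the summable bound [2^-n] on that of [D n]. *)
  have c0 : (0 : R) < 2^-1 ^+ n by rewrite exprn_gt0// invr_gt0.
  have := mean_mul_le (D2 n) (L2_cst P 1) c0; rewrite mean_cst expr1n mulr1.
  rewrite (_ : (fun w => D n w * 1) = D n); last by apply/funext => w; rewrite mulr1.
  rewrite ger0_norm ?mean_ge0//.
  have : mean P (fun w => D n w ^+ 2) <= (2^-1 ^+ n) ^+ 2.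
    rewrite -exprM mulnC exprM expr2 -invfM -natrM.
    rewrite (_ : (fun w => _) = fun w => (f n.+1 w - f n w) ^+ 2) ?fc//.
    by apply/funext => w; rewrite real_normK// num_real.
  set c := 2^-1 ^+ n; set m := mean P _ => mc.
  have : c^-1 * m <= c by rewrite mulrC ler_pdivrMr// -expr2.
  lra.
pose g w := (\sum_(n <oo) (D n w)%:E)%E.
have gfin : {ae P, forall w, (g w < +oo)%E}.
  have mg : measurable_fun [set: Omega] g.
    apply: ge0_emeasurable_sum => //.
    - by move=> n w _ _; rewrite lee_fin.
    - by move=> n _; exact/measurable_EFinP.
  have g0 w : (0 <= g w)%E by apply: nneseries_ge0 => n _ _; rewrite lee_fin.
  have gi : P.-integrable [set: Omega] g.
    apply/integrableP; split=> //.
    under eq_integral do rewrite gee0_abs//.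
    rewrite integral_nneseries//; last 2 first.
    - by move=> n; exact/measurable_EFinP.
    - by move=> n w _; rewrite lee_fin.
    apply: (@le_lt_trans _ _ 2%:E); last exact: ltry.
    apply: lime_le.
      apply: is_cvg_nneseries => n _ _; apply: integral_ge0 => w _.
      by rewrite lee_fin.
    apply: nearW => n.
    under eq_bigr do rewrite (integral_mean (L2_L1 (D2 _))).
    rewrite sumEFin lee_fin.
    have := @geometric_le_lim R n 1 (2^-1) ler01.
    rewrite invr_gt0 ltr0n ger0_norm ?invr_ge0// invf_lt1// ltr1n => /(_ isT isT).
    rewrite (_ : 1 * (1 - 2^-1)^-1 = 2); last by field.
    apply: le_trans; rewrite /series/=; apply: ler_sum => k _.
    by rewrite mul1r meanDle.
  apply: filterS (integrable_ae measurableT gi) => w /(_ Logic.I).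
  by rewrite ge0_fin_numE.
have [N [mN PN gN]] := gfin.
have cvgf w : ~ N w -> cvgn (f ^~ w).
  move=> Nw; have gw : (g w < +oo)%E by apply: contrapT => /gN.
  have cD : cvgn (series (D ^~ w)).
    apply: nondecreasing_is_cvgn.
      by apply/nondecreasing_seqP => n; rewrite !seriesEnat/= big_nat_recr//= lerDl.
    exists (fine (g w)) => _ [n _ <-].
    rewrite -lee_fin fineK; last first.
      by rewrite ge0_fin_numE//; apply: nneseries_ge0 => k _ _; rewrite lee_fin.
    rewrite seriesEnat/= -sumEFin; apply: nneseries_lim_ge => k _.
    by rewrite lee_fin.
  have : cvgn (series (telescope (f ^~ w))).
    by apply: normed_cvg.
  rewrite telescopeK => /cvg_ex[l fl]; apply/cvg_ex; exists (l + f 0%N w).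
  rewrite (_ : f ^~ w = (fun n => (f n w - f 0%N w) + f 0%N w)).
    by apply: cvgD => //; exact: cvg_cst.
  by apply/funext => n; rewrite subrK.
(* Setting [f n] to 0 on the null set [N] makes the limit exist everywhere, so that it is
   measurable. *)
pose f' n w := f n w * \1_(~` N) w.
have f'_ae n : {ae P, forall w, f' n w = f n w}.
  exists N; split=> // w /= fw; apply: contrapT => Nw; apply: fw.
  by rewrite /f' indicE mem_set// mulr1.
have mf' n : measurable_fun [set: Omega] (f' n).
  apply: measurable_funM => //; apply: measurable_indic; exact: measurableC.
pose X w := limn (f' ^~ w).
have f'X w : f' ^~ w @ \oo --> X w.
  apply/cvg_ex; have [Nw|Nw] := pselect (N w).
    exists 0; rewrite (_ : f' ^~ w = fun=> 0); first exact: cvg_cst.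
    by apply/funext => n; rewrite /f' indicE memNset ?mulr0//=; apply.
  have /cvg_ex[l fl] := cvgf w Nw; exists l.
  rewrite (_ : f' ^~ w = f ^~ w)//.
  by apply/funext => n; rewrite /f' indicE mem_set// mulr1.
have mX : measurable_fun [set: Omega] X.
  by apply: (measurable_fun_cvg mf') => w _; exact: f'X.
have Xf n : (\int[P]_w ((X w - f n w) ^+ 2)%:E <= (4^-1 ^+ n)%:E)%E.
  pose h m w := ((f' (n + m)%N w - f' n w) ^+ 2)%:E.
  rewrite (_ : (\int[P]_w _)%E = \int[P]_w limn_einf (h ^~ w))%E; last first.
    transitivity (\int[P]_w ((X w - f' n w) ^+ 2)%:E)%E.
      apply: ae_eq_integral => //.
      - by apply/measurable_EFinP/measurable_funX/measurable_funB.
      - by apply/measurable_EFinP/measurable_funX/measurable_funB.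
      - by apply: filterS (f'_ae n) => w -> _.
    apply: eq_integral => w _.
    suff hX : h ^~ w @ \oo --> ((X w - f' n w) ^+ 2)%:E.
      by have [-> _] := cvg_limn_einf_sup hX.
    apply: cvg_EFin; first exact: nearW.
    have fnX : (fun m => f' (n + m)%N w) @ \oo --> X w.
      exact: (cvg_comp (addn n) (f' ^~ w) (cvg_addnl n) (f'X w)).
    rewrite /comp/=; under eq_fun do rewrite expr2; rewrite expr2.
    by apply: cvgM; apply: cvgB => //; exact: cvg_cst.
  apply: le_trans (fatou P measurableT _ _) _.
  - by move=> m; apply/measurable_EFinP/measurable_funX/measurable_funB.
  - by move=> m w _; rewrite lee_fin sqr_ge0.
  rewrite limn_einf_lim; apply: lime_le; first exact: is_cvg_einfs.
  apply: nearW => m; apply: (@le_trans _ _ (\int[P]_w h m w)%E).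
    by apply: ereal_inf_lbound; exists m => /=.
  rewrite (_ : (\int[P]_w _)%E =
      \int[P]_w ((f (n + m)%N w - f n w) ^+ 2)%:E)%E; last first.
    apply: ae_eq_integral => //.
    - by apply/measurable_EFinP/measurable_funX/measurable_funB.
    - by apply/measurable_EFinP/measurable_funX/measurable_funB.
    - by apply: filterS2 (f'_ae n) (f'_ae (n + m)%N) => w; rewrite /h => -> -> _.
  rewrite integral_mean; first by rewrite lee_fin fc// leq_addr.
  by have [] := L2B (f2 (n + m)%N) (f2 n).
have Xf2 n : L2 P (fun w => X w - f n w).
  split; first exact: measurable_funB.
  apply/integrableP; split.
    by apply/measurable_EFinP/measurable_funX/measurable_funB.
  under eq_integral do rewrite /= ger0_norm ?sqr_ge0//.
  by rewrite (le_lt_trans (Xf n))// ltry.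
exists X.
  rewrite (_ : X = fun w => (X w - f 0%N w) + f 0%N w); first exact: L2D.
  by apply/funext => w; rewrite subrK.
by move=> n; rewrite -lee_fin -integral_mean//; have [] := Xf2 n.
Qed.

Section L2_sums.
Context {d : measure_display} {Omega : measurableType d} {R : realType}.
Variable P : probability Omega R.
Local Notation mean := (mean P).
Local Notation L1 := (L1 P).
Local Notation L2 := (L2 P).

Section family.
Context {K : choiceType}.
Variables (D : set K) (u : K -> Omega -> R).
Hypothesis u2 : forall i, D i -> L2 (u i).
Implicit Types (X Y v : Omega -> R) (B : {fset K}).

Lemma L2_fsum B : [set` B] `<=` D -> L2 (fun w => \sum_(i <- B) u i w).
Proof. by move=> BD; apply: L2_sum => i iB; exact/u2/BD. Qed.

(** The condition at [eps = 1] puts [X] at finite distance from a finite sum. *)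
Lemma is_L2sum_L2 X : is_L2sum P D u X -> L2 X.
Proof.
move=> [mX /(_ 1 ltr01)[A AD /(_ A (fsubset_refl A) AD) XA]].
rewrite (_ : X = fun w => (X w - \sum_(i <- A) u i w) + \sum_(i <- A) u i w);
  last by apply/funext => w; rewrite subrK.
have [mS _] := L2_fsum AD.
have mXS : measurable_fun [set: Omega] (fun w => X w - \sum_(i <- A) u i w).
  exact: measurable_funB.
apply: L2D; last exact: L2_fsum.
split=> //; apply/integrableP; split.
  by apply/measurable_EFinP; exact: measurable_funX.
rewrite (le_lt_trans _ (lt_trans XA (ltry _)))//.
rewrite le_eqVlt; apply/orP; left; apply/eqP; apply: eq_integral => w _.
by rewrite /= ger0_norm// sqr_ge0.
Qed.

Lemma is_L2sumP X : L2 X ->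
  is_L2sum P D u X <->
  forall eps : R, 0 < eps -> exists2 A : {fset K}, [set` A] `<=` D &
    forall B, (A `<=` B)%fset -> [set` B] `<=` D ->
      mean (fun w => (X w - \sum_(i <- B) u i w) ^+ 2) < eps.
Proof.
move=> X2; have L1B B : [set` B] `<=` D ->
    L1 (fun w => (X w - \sum_(i <- B) u i w) ^+ 2).
  by move=> BD; have [] := L2B X2 (L2_fsum BD).
split=> [[_ Xu] eps /Xu[A AD AB]|Xu].
  exists A => // B BA BD; rewrite -lte_fin -integral_mean; last exact: L1B.
  exact: AB.
split; first by case: X2.
move=> eps /Xu[A AD AB]; exists A => // B /AB BA BD.
rewrite integral_mean ?lte_fin ?BA//; exact: L1B.
Qed.

(** Beyond the union of two thresholds, one partial sum [S] has squared distance below [e / 4] from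
    both limits, and [(X - Y)^2 <= 2 (X - S)^2 + 2 (Y - S)^2]. *)
Lemma is_L2sum_unique X Y : is_L2sum P D u X -> is_L2sum P D u Y ->
  {ae P, forall w, X w = Y w}.
Proof.
move=> Xu Yu; have X2 := is_L2sum_L2 Xu; have Y2 := is_L2sum_L2 Yu.
suff XY : mean (fun w => (X w - Y w) ^+ 2) = 0.
  apply: filterS (mean_sqr_eq0 (L2B X2 Y2) XY) => w /eqP.
  by rewrite subr_eq0 => /eqP.
have XY0 : 0 <= mean (fun w => (X w - Y w) ^+ 2).
  by apply: mean_ge0 => w; exact: sqr_ge0.
apply/eqP; rewrite eq_le XY0 andbT; apply/ler_addgt0Pl => e e0; rewrite addr0.
have e4 : 0 < e / 4 by lra.
have [A AD XA] := (is_L2sumP X2).1 Xu _ e4.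
have [B BD YB] := (is_L2sumP Y2).1 Yu _ e4.
pose C := (A `|` B)%fset.
have CD : [set` C] `<=` D.
  by move=> i /=; rewrite inE => /orP[]; [exact: AD|exact: BD].
have {}XA := XA C (fsubsetUl _ _) CD; have {}YB := YB C (fsubsetUr _ _) CD.
have C2 := L2_fsum CD.
have [_ XC1] := L2B X2 C2; have [_ YC1] := L2B Y2 C2.
pose S w := \sum_(i <- C) u i w.
apply: (@le_trans _ _ (mean (fun w => 2 * (X w - S w) ^+ 2 + 2 * (Y w - S w) ^+ 2))).
  apply: mean_le; [by case: (L2B X2 Y2)|by apply: L1D; exact: L1Z|].
  by move=> w; have := sqr_ge0 (X w + Y w - 2 * S w); nra.
rewrite meanD ?meanZ//; [|exact: L1Z|exact: L1Z].
rewrite /S; lra.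
Qed.

(** Pairing with a fixed [v] is continuous along the net of finite sets. *)
Lemma is_L2sum_mean X v : is_L2sum P D u X -> L2 v ->
  forall eps : R, 0 < eps -> exists2 A : {fset K}, [set` A] `<=` D &
    forall B, (A `<=` B)%fset -> [set` B] `<=` D ->
      `|mean (fun w => X w * v w) - \sum_(i <- B) mean (fun w => u i w * v w)|
      < eps.
Proof.
move=> Xu v2 eps eps0; have X2 := is_L2sum_L2 Xu.
pose m := mean (fun w => v w ^+ 2).
have m0 : 0 <= m by apply: mean_ge0 => w; exact: sqr_ge0.
(* This weight gives [c * m < eps]; asking the squared error to be below [c * eps] makes the other
   term of Young's inequality smaller than [eps] too. The pairing is at most half their sum. *)
pose c := eps / (1 + m).
have c0 : 0 < c by rewrite divr_gt0//; lra.
have [A AD XA] := (is_L2sumP X2).1 Xu _ (mulr_gt0 c0 eps0).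
exists A => // B AB BD; have B2 := L2_fsum BD.
have := mean_mul_le (L2B X2 B2) v2 c0; rewrite -/m => le2.
have cm : c * m < eps.
  rewrite /c mulrAC ltr_pdivrMr; last lra.
  by rewrite ltr_pM2l//; lra.
have lec : c^-1 * mean (fun w => (X w - \sum_(i <- B) u i w) ^+ 2) < eps.
  by rewrite mulrC ltr_pdivrMr// mulrC; apply: XA.
have E : mean (fun w => (X w - \sum_(i <- B) u i w) * v w) =
    mean (fun w => X w * v w) - \sum_(i <- B) mean (fun w => u i w * v w).
  have uv i : i \in B -> L1 (fun w => u i w * v w).
    by move=> iB; apply: L2M => //; exact/u2/BD.
  rewrite -mean_sum// -meanB; [|exact: L2M|exact: L1_sum].
  by congr mean; apply/funext => w; rewrite mulrBl mulr_suml.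
rewrite -E; lra.
Qed.

(** A [v] orthogonal to all terms but one reads off that term: enlarge the threshold set by [j] and
    a single summand remains. *)
Lemma is_L2sum_coef X v j : is_L2sum P D u X -> L2 v -> D j ->
  (forall i, D i -> i <> j -> mean (fun w => u i w * v w) = 0) ->
  mean (fun w => X w * v w) = mean (fun w => u j w * v w).
Proof.
move=> Xu v2 Dj uv0; apply/eqP; rewrite -subr_eq0 -normr_le0.
apply/ler_addgt0Pl => e e0; rewrite addr0.
have [A AD XA] := is_L2sum_mean Xu v2 e0.
have jAD : [set` (j |` A)%fset] `<=` D.
  by move=> i /=; rewrite !inE => /orP[/eqP ->//|]; exact: AD.
have := XA (j |` A)%fset (fsubsetU1 _ _) jAD.
rewrite (big_fsetD1 j)/= ?fset1U1// big_seq big1 ?addr0; first exact: ltW.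
move=> i; rewrite !inE => /andP[/eqP ij /orP[/eqP//|iA]].
by apply: uv0 => //; exact: AD.
Qed.

Hypothesis orth : forall i j, D i -> D j -> i <> j ->
  mean (fun w => u i w * u j w) = 0.

Lemma mean_sqr_fsum B : [set` B] `<=` D ->
  mean (fun w => (\sum_(i <- B) u i w) ^+ 2) =
  \sum_(i <- B) mean (fun w => u i w ^+ 2).
Proof.
move=> BD.
have uu i j : i \in B -> j \in B -> L1 (fun w => u i w * u j w).
  by move=> iB jB; apply: L2M; [exact/u2/BD|exact/u2/BD].
transitivity (mean (fun w => \sum_(i <- B) \sum_(j <- B) u i w * u j w)).
  congr mean; apply/funext => w; rewrite expr2 mulr_suml.
  by apply: eq_bigr => i _; rewrite mulr_sumr.
rewrite mean_sum => [|i iB]; last by apply: L1_sum => j jB; exact: uu.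
apply: eq_big_seq => i iB; rewrite mean_sum => [|j jB]; last exact: uu.
rewrite (big_fsetD1 i)//= big_seq big1 ?addr0; first by congr mean.
move=> j; rewrite !inE => /andP[/eqP ji jB]; apply: orth => //.
- exact: BD.
- exact: BD.
- by move=> ij; apply: ji.
Qed.

(** Pythagoras. The pairing hypothesis says that each [u i] is the projection of [X] on its own
    line, so that the finite sum is the projection on their span. *)
Lemma mean_sqr_sub_fsum X B : L2 X -> [set` B] `<=` D ->
  (forall i, D i -> mean (fun w => X w * u i w) = mean (fun w => u i w ^+ 2)) ->
  mean (fun w => (X w - \sum_(i <- B) u i w) ^+ 2) =
  mean (fun w => X w ^+ 2) - \sum_(i <- B) mean (fun w => u i w ^+ 2).
Proof.
move=> X2 BD Xu; have B2 := L2_fsum BD.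
have Xu1 i : i \in B -> L1 (fun w => X w * u i w).
  by move=> iB; apply: L2M => //; exact/u2/BD.
transitivity (mean (fun w => (X w ^+ 2 - 2 * \sum_(i <- B) X w * u i w) +
    (\sum_(i <- B) u i w) ^+ 2)).
  by congr mean; apply/funext => w; rewrite -mulr_sumr; ring.
rewrite meanD; [|apply: L1B; [by case: X2|exact/L1Z/L1_sum]|by case: B2].
rewrite meanB; [|by case: X2|exact/L1Z/L1_sum].
rewrite meanZ ?mean_sum//; last exact: L1_sum.
rewrite mean_sqr_fsum// (eq_big_seq (fun i => mean (fun w => u i w ^+ 2))).
  by ring.
by move=> i iB; apply/Xu/BD.
Qed.

Lemma bessel X B : L2 X -> [set` B] `<=` D ->
  (forall i, D i -> mean (fun w => X w * u i w) = mean (fun w => u i w ^+ 2)) ->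
  \sum_(i <- B) mean (fun w => u i w ^+ 2) <= mean (fun w => X w ^+ 2).
Proof.
move=> X2 BD Xu; rewrite -subr_ge0 -mean_sqr_sub_fsum//.
by apply: mean_ge0 => w; exact: sqr_ge0.
Qed.

(** By Pythagoras the squared error is a difference of norms and decreases as the finite set grows,
    so a set carrying all but [eps] of the norm is a threshold. *)
Lemma parseval_is_L2sum X : L2 X ->
  (forall i, D i -> mean (fun w => X w * u i w) = mean (fun w => u i w ^+ 2)) ->
  (forall eps : R, 0 < eps -> exists2 A : {fset K}, [set` A] `<=` D &
    mean (fun w => X w ^+ 2) < \sum_(i <- A) mean (fun w => u i w ^+ 2) + eps) ->
  is_L2sum P D u X.
Proof.
move=> X2 Xu XA; apply/is_L2sumP => // eps /XA[A AD lA]; exists A => // B AB BD.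
rewrite mean_sqr_sub_fsum// ltrBlDl; apply: lt_le_trans lA _.
rewrite lerD2r (sum_fsetD _ AB) lerDl; apply: sumr_ge0 => i _.
by apply: mean_ge0 => w; exact: sqr_ge0.
Qed.

(** Finite sets with energy within [4^-n] of the supremum, made increasing by unions, have partial
    sums that are Cauchy at the rate of [L2_complete]. The limit holds along the whole net, since
    any larger set adds at most [4^-n] of energy. *)
Lemma summable_is_L2sum (C : R) :
  (forall B, [set` B] `<=` D -> \sum_(i <- B) mean (fun w => u i w ^+ 2) <= C) ->
  exists X, is_L2sum P D u X.
Proof.
move=> uC; pose q B := \sum_(i <- B) mean (fun w => u i w ^+ 2).
pose S := [set q B | B in [set B : {fset K} | [set` B] `<=` D]].
have supS : has_sup S.
  split; first by exists (q fset0), fset0.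
  by exists C => _ [B BD <-]; exact: uC.
pose dlt n : R := 4^-1 ^+ n.
have dlt0 n : 0 < dlt n by rewrite exprn_gt0// invr_gt0.
have /choice[A_ A_P] : forall n, exists A : {fset K}, [set` A] `<=` D /\
    sup S < q A + dlt n.
  move=> n; have [_ [A AD <-] lA] := sup_adherent (dlt0 n) supS.
  by exists A; split=> //; rewrite -ltrBlDr.
pose A := fix A n := if n is m.+1 then (A_ m.+1 `|` A m)%fset else A_ 0%N.
have AD n : [set` A n] `<=` D.
  elim: n => [|n IH]; first by case: (A_P 0%N).
  by move=> i; rewrite /= inE => /orP[]; [case: (A_P n.+1) => + _; apply|exact: IH].
have qmono B B' : (B `<=` B')%fset -> q B <= q B'.
  move=> BB'; rewrite /q (sum_fsetD _ BB') lerDl; apply: sumr_ge0 => i _.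
  by apply: mean_ge0 => w; exact: sqr_ge0.
have qA n : sup S < q (A n) + dlt n.
  have [_ +] := A_P n; move=> /lt_le_trans; apply; rewrite lerD2r; apply: qmono.
  by case: n => [|n]//=; exact: fsubsetUl.
have near_ n B : (A n `<=` B)%fset -> [set` B] `<=` D ->
    mean (fun w => (\sum_(i <- B) u i w - \sum_(i <- A n) u i w) ^+ 2) <= dlt n.
  move=> AB BD.
  have BAD : [set` (B `\` A n)%fset] `<=` D.
    by move=> i; rewrite /= inE => /andP[_]; exact: BD.
  rewrite (_ : mean _ = q (B `\` A n)%fset).
    have : q B <= sup S by apply: (sup_upper_bound supS); exists B.
    have := qA n; rewrite /q (sum_fsetD _ AB) => h1 h2; lra.
  rewrite /q -mean_sqr_fsum//; congr mean; apply/funext => w.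
  by rewrite (sum_fsetD _ AB) addrC addKr.
have Amono n m : (n <= m)%N -> (A n `<=` A m)%fset.
  move=> /subnKC <-; elim: (m - n)%N => [|k IH]; first by rewrite addn0.
  by rewrite addnS /=; apply: fsubset_trans IH _; exact: fsubsetUr.
have [|n m nm|X X2 XA] := @L2_complete _ _ _ P (fun n w => \sum_(i <- A n) u i w).
- by move=> n; exact: L2_fsum.
- by apply: near_; [exact: Amono|exact: AD].
exists X; apply/is_L2sumP => // eps eps0.
have [n dn] : exists n, 4 * dlt n < eps.
  have : (fun n => 4 * dlt n) @ \oo --> 4 * (0 : R).
    by apply: cvgMr; apply: cvg_expr; rewrite ger0_norm ?invr_ge0//; lra.
  rewrite mulr0 => /cvgr0Pnorm_lt /(_ _ eps0) [N _ /(_ N (leqnn N))].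
  by move=> /(le_lt_trans (ler_norm _)) ?; exists N.
exists (A n); first exact: AD.
move=> B AB BD; apply: le_lt_trans dn.
have B2 := L2_fsum BD; have A2 := L2_fsum (AD n).
apply: (@le_trans _ _ (mean (fun w => 2 * (X w - \sum_(i <- A n) u i w) ^+ 2 +
   2 * (\sum_(i <- B) u i w - \sum_(i <- A n) u i w) ^+ 2))).
  have [_ ?] := L2B X2 A2; have [_ ?] := L2B B2 A2.
  apply: mean_le; [by case: (L2B X2 B2)|by apply: L1D; exact: L1Z|].
  move=> w; set a := X w; set b := \sum_(_ <- B) _; set c := \sum_(_ <- _) _.
  by have := sqr_ge0 (a + b - 2 * c); nra.
have [_ ?] := L2B X2 A2; have [_ ?] := L2B B2 A2.
rewrite meanD ?meanZ//; [|exact: L1Z|exact: L1Z].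
have := near_ _ _ AB BD; have := XA n; rewrite -/(dlt n) => h1 h2; lra.
Qed.

Lemma is_L2sum_L2sum X : is_L2sum P D u X -> is_L2sum P D u (L2sum P D u).
Proof. by move=> Xu; apply: (xgetPex (fun=> 0)); exists X. Qed.

End family.

(** The two limit predicates are equal as sets, so the same version is chosen: the equality is
    everywhere, not just almost sure. *)
Lemma eq_L2sum {K : choiceType} (D : set K) (u v : K -> Omega -> R) :
  (forall i, D i -> u i = v i) -> L2sum P D u = L2sum P D v.
Proof.
move=> uv; congr xget; apply/seteqP; split=> X [mX Xu]; split=> // eps /Xu.
  move=> [A AD XA]; exists A => // B AB BD; move: (XA B AB BD).
  by under eq_integral do under eq_big_seq => i iB do rewrite (uv i (BD i iB)).
move=> [A AD XA]; exists A => // B AB BD; move: (XA B AB BD).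
by under eq_integral do under eq_big_seq => i iB do rewrite -(uv i (BD i iB)).
Qed.

End L2_sums.

(** * Slots of the marked process *)

Section slots.
Context {Omega : Type}.
Variables (gap : nat -> Omega -> nat) (V : nat -> Omega -> int).
Implicit Types (w : Omega) (t : nat) (o : seq (option int)).

(** The variable [X_t]. When the gaps are positive, [eta_unique] leaves [xget] a single
    candidate. *)
Definition slotv t w : option int :=
  if pselect (exists k, eta gap V w (t, k)) is left _
  then Some (xget 0 [set k | eta gap V w (t, k)]) else None.

Definition slots t w : seq (option int) := mkseq (fun s => slotv s.+1 w) t.

Lemma size_slots t w : size (slots t w) = t.
Proof. by rewrite size_mkseq. Qed.

Lemma slotsS t w : slots t.+1 w = rcons (slots t w) (slotv t.+1 w).
Proof. exact: mkseqS. Qed.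

Hypothesis gap_gt0 : forall i w, (0 < gap i w)%N.

(** Shifted by one from [arrival]: [tau 0] is 0 and [arrival i] is [tau i.+1], so that gap [i]
    covers the slots in []tau i, tau i.+1]]. *)
Let tau i w := (\sum_(j < i) gap j w)%N.

Let tauS i w : tau i.+1 w = (tau i w + gap i w)%N.
Proof. by rewrite /tau big_ord_recr. Qed.

Let tau_lt i j w : (i < j)%N -> (tau i w < tau j w)%N.
Proof.
elim: j => // j IH; rewrite ltnS leq_eqVlt => /predU1P[->|/IH h].
  by rewrite tauS -addn1 leq_add2l.
by rewrite tauS ltn_addr.
Qed.

Let tau_le i j w : (i <= j)%N -> (tau i w <= tau j w)%N.
Proof. by rewrite leq_eqVlt => /predU1P[->//|/tau_lt/ltnW]. Qed.

Let eta_slot w t k i : (tau i w < t <= tau i.+1 w)%N ->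
  eta gap V w (t, k) <-> t = tau i.+1 w /\ V i w = k.
Proof.
move=> /andP[it ti]; split=> [[j /= [jt Vj]]|[-> <-]]; last by exists i.
have {}jt : tau j.+1 w = t by [].
have [ij|ji|ij] := ltngtP i j; last by rewrite ij.
  by have := leq_ltn_trans ti (tau_lt w (ij : (i.+1 < j.+1)%N)); rewrite jt ltnn.
by have := leq_trans it ti; have := tau_le w ji; rewrite jt leqNgt it.
Qed.

Lemma eta_unique w t k k' : eta gap V w (t, k) -> eta gap V w (t, k') -> k = k'.
Proof.
move=> /= [i /= [it <-]]; have ti : t = tau i.+1 w by [].
by move=> /(@eta_slot w t k' i)[]; rewrite ti ?leqnn ?tau_lt.
Qed.

Lemma slotv_Some t k w : slotv t w = Some k <-> eta gap V w (t, k).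
Proof.
rewrite /slotv; case: pselect => [ex|nex]; last first.
  by split=> // h; case: nex; exists k.
have := xgetPex 0 ex; rewrite /= => h; split=> [[<-//]|h'].
by congr Some; exact: eta_unique h h'.
Qed.

Lemma slotv_None t w : slotv t w = None <-> forall k, ~ eta gap V w (t, k).
Proof.
split=> [h k /slotv_Some|h]; first by rewrite h.
by case e : (slotv t w) => [k|//]; move/slotv_Some : e => /h.
Qed.

Lemma slotE t x : slot gap V t x = slotv t @^-1` [set x].
Proof.
apply/seteqP; case: x => [k|]; split=> w /=; first by move/slotv_Some.
- by move/slotv_Some.
- by move/slotv_None.
- by move/slotv_None.
Qed.

Let slotvE w t i : (tau i w < t <= tau i.+1 w)%N ->
  slotv t w = if t == tau i.+1 w then Some (V i w) else None.
Proof.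
move=> it; case: ifPn => [/eqP h|/eqP h].
  by apply/slotv_Some/(eta_slot _ it).
by apply/slotv_None => k /(eta_slot _ it)[].
Qed.

(* The complete gaps and their marks, and the age of the running gap, after a
   finite sequence of slots. *)
Definition parse_step (sa : seq (nat * int) * nat) (x : option int) :=
  if x is Some k then (rcons sa.1 (sa.2.+1, k), 0%N) else (sa.1, sa.2.+1).

Definition parse_slots o := foldl parse_step ([::], 0%N) o.

Lemma parse_rcons o x : parse_slots (rcons o x) = parse_step (parse_slots o) x.
Proof. by rewrite /parse_slots -cats1 foldl_cat. Qed.

Definition gap_spec (sa : seq (nat * int) * nat) i : set nat :=
  if (i < size sa.1)%N then [set (nth (0%N, 0) sa.1 i).1] else [set g | (sa.2 < g)%N].

Definition mark_spec (sa : seq (nat * int) * nat) i : set int :=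
  if (i < size sa.1)%N then [set (nth (0%N, 0) sa.1 i).2] else setT.

(** Written as the intersection appearing in [mutual_indep]. The last index stands for the running
    gap, known only to exceed its age, with a free mark. *)
Definition renewal_event (sa : seq (nat * int) * nat) : set Omega :=
  \bigcap_(i in `I_(size sa.1).+1)
    (gap i @^-1` gap_spec sa i `&` V i @^-1` mark_spec sa i).

Let renewal_eventP s a w : renewal_event (s, a) w <->
  (forall i, (i < size s)%N -> (gap i w, V i w) = nth (0%N, 0) s i) /\
  (a < gap (size s) w)%N.
Proof.
split=> [h|[h1 h2] i /=].
  split=> [i si|].
    have [] := h i (leqW si : (_ <= _)%N); rewrite /gap_spec /mark_spec si /=.
    by move=> -> ->; case: nth.
  by have [] := h (size s) (ltnSn _); rewrite /gap_spec /= ltnn.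
rewrite ltnS leq_eqVlt => /predU1P[->|si].
  by rewrite /gap_spec /mark_spec /= ltnn.
by rewrite /gap_spec /mark_spec /= si -h1.
Qed.

(** Observing finitely many slots amounts to observing the complete gaps, their marks and a lower
    bound on the running gap. This turns an event on slots into a rectangle for the independent
    variables. *)
Lemma slots_parse o w :
  slots (size o) w = o <-> renewal_event (parse_slots o) w.
Proof.
(* The added invariant locates the current time: last arrival plus age. *)
suff [] : (slots (size o) w = o <-> renewal_event (parse_slots o) w) /\
  (renewal_event (parse_slots o) w ->
   (tau (size (parse_slots o).1) w + (parse_slots o).2 = size o)%N) by [].
elim/last_ind: o => [|o x [IH IHt]].
  split; last by move=> _; rewrite /= /tau big_ord0.
  split=> // _; apply/renewal_eventP; split=> //; exact: gap_gt0.
rewrite parse_rcons size_rcons slotsS.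
have step : rcons (slots (size o) w) (slotv (size o).+1 w) = rcons o x <->
    slots (size o) w = o /\ slotv (size o).+1 w = x.
  by split=> [/rcons_inj[]|[-> ->]].
case: (parse_slots o) IH IHt => s a IH IHt.
suff key : renewal_event (s, a) w -> (slotv (size o).+1 w = x <->
    renewal_event (parse_step (s, a) x) w).
  have sub : renewal_event (parse_step (s, a) x) w -> renewal_event (s, a) w.
    case: {key step} x => [k|] /renewal_eventP/= [h1 h2]; apply/renewal_eventP.
      split=> [i si|].
        by rewrite h1 ?size_rcons ?(leqW si)// nth_rcons si.
      have := h1 (size s); rewrite size_rcons ltnSn nth_rcons ltnn eqxx.
      by move=> /(_ isT)[-> _].
    by split=> //; exact: ltnW.
  split.
    split=> [/step[/IH sa /(key sa)//]|h].
    by apply/step; have sa := sub h; split; [exact/IH|exact/(key sa)].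
  move=> h; have sa := sub h; have /= := IHt sa.
  case: {key step sub} x h => [k|] /=; last by rewrite addnS => _ ->.
  move=> /renewal_eventP[/(_ (size s))]; rewrite size_rcons ltnSn nth_rcons.
  by rewrite ltnn eqxx => /(_ isT)[gs _] _; rewrite tauS gs addn0 addnS => ->.
move=> sa; have /= ta := IHt sa; have /renewal_eventP[h1 h2] := sa.
(* The new slot lies in the running interval, so it is occupied exactly when the gap equals the age
   plus one. *)
have wi : (tau (size s) w < (size o).+1 <= tau (size s).+1 w)%N.
  by rewrite tauS -ta ltnS leq_addr -addnS leq_add2l.
rewrite (slotvE wi) tauS -ta -addnS eqn_add2l.
case: x {step} => [k|] /=; case: ifPn => [/eqP gs|/eqP gs]; split=> //.
- move=> [Vk]; apply/renewal_eventP; rewrite size_rcons; split=> // i.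
  rewrite ltnS leq_eqVlt nth_rcons => /predU1P[->|si].
    by rewrite ltnn eqxx -gs Vk.
  by rewrite si; exact: h1.
- move=> /renewal_eventP[/(_ (size s))]; rewrite size_rcons ltnSn nth_rcons.
  by rewrite ltnn eqxx => /(_ isT)[_ ->].
- move=> /renewal_eventP[/(_ (size s))]; rewrite size_rcons ltnSn nth_rcons.
  by rewrite ltnn eqxx => /(_ isT)[/esym].
- by move=> /renewal_eventP[_]; rewrite -gs ltnn.
- move=> _; apply/renewal_eventP; split=> //.
  by rewrite ltn_neqAle h2 andbT; apply/eqP.
Qed.

End slots.
Arguments slots : simpl never.
Arguments slotv : simpl never.

(** * The law of a finite word of slots *)

Definition slot_law {R : realType} (lam : R) (Q : probability int R)
    (x : option int) : R :=
  if x is Some k then lam * fine (Q [set k]) else 1 - lam.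

Section slot_probabilities.
Context {d : measure_display} {Omega : measurableType d} {R : realType}.
Variables (P : probability Omega R) (lam : R) (E : set int)
  (Q : probability int R).
Variables (gap : nat -> {RV P >-> nat}) (V : nat -> {RV P >-> int}).
Hypothesis mbp : marked_binomial lam E Q gap V.

Local Notation slotv := (slotv gap V).
Local Notation slots := (slots gap V).

Let gap0 i w : (0 < gap i w)%N. Proof. exact: (gap_gt0 mbp). Qed.

Lemma slots_fiberE o :
  slots (size o) @^-1` [set o] = renewal_event gap V (parse_slots o).
Proof. by apply/seteqP; split=> w /=; have [] := slots_parse (fun i => V i) gap0 o w. Qed.

Let mgap i (A : set nat) : measurable (gap i @^-1` A).
Proof. by rewrite -[X in measurable X]setTI; exact: measurable_funP. Qed.

Let mV i (A : set int) : measurable (V i @^-1` A).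
Proof. by rewrite -[X in measurable X]setTI; exact: measurable_funP. Qed.

Lemma measurable_slots t o : measurable (slots t @^-1` [set o]).
Proof.
have [to|to] := eqVneq (size o) t; last first.
  rewrite (_ : _ @^-1` _ = set0)//; apply/seteqP; split=> w //= h.
  by move: to; rewrite -h size_slots eqxx.
rewrite -to slots_fiberE; apply: bigcap_measurable; first by exists 0%N.
by move=> i _; exact: measurableI.
Qed.

Let Pfin A : measurable A -> P A \is a fin_num.
Proof. by move=> mA; exact: fin_num_measure. Qed.

Let prob_gap_gt i a : fine (P (gap i @^-1` [set g | (a < g)%N])) = (1 - lam) ^+ a.
Proof.
elim: a => [|a IH].
  rewrite (_ : gap i @^-1` _ = setT); first by rewrite probability_setT.
  by apply/seteqP; split=> w //= _.
have : P (gap i @^-1` [set g | (a < g)%N]) =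
    (P (gap i @^-1` [set a.+1]) + P (gap i @^-1` [set g | (a.+1 < g)%N]))%E.
  rewrite -measureU//; last first.
    by rewrite -subset0 => w /= [->]; rewrite ltnn.
  congr (P _); apply/seteqP; split=> w /=.
    by rewrite leq_eqVlt => /predU1P[<-|]; [left|right].
  by move=> [->//|]; exact: ltnW.
move=> /(congr1 fine); rewrite IH fineD ?Pfin// (gap_law mbp)/= exprS => h.
by rewrite mulrBl mul1r {1}h; ring.
Qed.

Let gap_prob n : R := if n is m.+1 then lam * (1 - lam) ^+ m else 0.

Let prob_gap_eq i n : fine (P (gap i @^-1` [set n])) = gap_prob n.
Proof.
case: n => [|n]; last by rewrite (gap_law mbp).
rewrite (_ : gap i @^-1` _ = set0) ?measure0//.
by apply/seteqP; split=> w //= h; have := gap0 i w; rewrite h.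
Qed.

Let prob_renewal s a : fine (P (renewal_event gap V (s, a))) =
  (\prod_(p <- s) (gap_prob p.1 * fine (Q [set p.2]))) * (1 - lam) ^+ a.
Proof.
rewrite (mutual_indep mbp) big_ord_recr/=; congr (_ * _).
  rewrite (big_nth (0%N, 0)) big_mkord; apply: eq_bigr => i _.
  by rewrite /gap_spec /mark_spec/= ltn_ord prob_gap_eq (mark_law mbp).
rewrite /gap_spec /mark_spec/= ltnn prob_gap_gt preimage_setT.
by rewrite probability_setT mulr1.
Qed.

(** Absence of memory appears here: an empty slot multiplies the tail [(1 - lam)^a] of the running
    gap by [1 - lam], and an occupied one replaces it by the mass [lam (1 - lam)^a] times the mass
    of the mark. The factor never depends on the age [a]. *)
Lemma prob_slots_size o :
  P (slots (size o) @^-1` [set o]) = (\prod_(x <- o) slot_law lam Q x)%:E.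
Proof.
rewrite -[LHS]fineK ?Pfin//; last exact: measurable_slots.
congr EFin; elim/last_ind: o => [|o x IH].
  rewrite big_nil (_ : _ @^-1` _ = setT); first by rewrite probability_setT.
  by apply/seteqP; split=> w //= _.
rewrite -cats1 big_cat big_seq1/= -IH cats1 !slots_fiberE parse_rcons.
case: (parse_slots o) => s a; rewrite prob_renewal; case: x => [k|]/=.
  rewrite prob_renewal -cats1 big_cat big_seq1/= expr0 mulr1; ring.
by rewrite prob_renewal exprS; ring.
Qed.

Lemma prob_slots t o : P (slots t @^-1` [set o]) =
  (if size o == t then \prod_(x <- o) slot_law lam Q x else 0)%:E.
Proof.
case: eqVneq => [<-|to]; first exact: prob_slots_size.
rewrite (_ : _ @^-1` _ = set0) ?measure0//; apply/seteqP; split=> w //= h.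
by move: to; rewrite -h size_slots eqxx.
Qed.

End slot_probabilities.

(** * Independence of the slots *)

Section countable_valued.
Context {d : measure_display} {Omega : measurableType d} {R : realType}.
Variable mu : {measure set Omega -> \bar R}.
Context {K : countType}.
Variable Y : Omega -> K.
Hypothesis mY : forall y, measurable (Y @^-1` [set y]).

Let fiber n : set Omega := [set w | choice.pickle (Y w) = n].

Let mfiber n : measurable (fiber n).
Proof.
case e : (choice.pickle_inv n) => [y|].
  rewrite (_ : fiber n = Y @^-1` [set y])//; apply/seteqP; split=> w.
    by rewrite /fiber /= => h; move: e; rewrite -h choice.pickleK_inv => -[].
  by rewrite /fiber /= => ->; have := @choice.pickle_invK K n; rewrite e.
rewrite (_ : fiber n = set0)//; apply/seteqP; split=> w //= h.
by move: e; rewrite -h choice.pickleK_inv.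
Qed.

Lemma measurable_preimage_countable (A : set K) : measurable (Y @^-1` A).
Proof.
rewrite (_ : _ @^-1` _ = \bigcup_(n in choice.pickle @` A) fiber n).
  by apply: bigcup_measurable.
apply/seteqP; split=> [w /= Aw|w [n [y Ay <-]]].
  by exists (choice.pickle (Y w)); [exists (Y w)|].
by rewrite /fiber/= => /(pcan_inj choice.pickleK) ->.
Qed.

Lemma measurable_comp_countable d' (S : measurableType d') (F : K -> S) :
  measurable_fun [set: Omega] (F \o Y).
Proof.
move=> _ B mB; rewrite setTI comp_preimage.
exact: measurable_preimage_countable.
Qed.

Lemma integral_countable (F : K -> \bar R) : (forall y, (0 <= F y)%E) ->
  (\int[mu]_w F (Y w) =
   \esum_(y in [set: K]) (F y * mu (Y @^-1` [set y])))%E.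
Proof.
move=> F0; have cover : \bigcup_n fiber n = [set: Omega].
  by apply/seteqP; split=> // w _; exists (choice.pickle (Y w)).
have triv : trivIset setT fiber.
  by move=> i j _ _ [w [/= <- <-]].
have -> : (\int[mu]_w F (Y w) = \int[mu]_(w in \bigcup_n fiber n) F (Y w))%E.
  by rewrite cover.
rewrite ge0_integral_bigcup//; last first.
  by rewrite cover; exact: (measurable_comp_countable F).
rewrite nneseries_esumT; last by move=> n; exact: integral_ge0.
have fiberE y : (\int[mu]_(w in fiber (choice.pickle y)) F (Y w) =
    F y * mu (Y @^-1` [set y]))%E.
  rewrite (_ : fiber _ = Y @^-1` [set y]); last first.
    by apply/seteqP; split=> w; rewrite /fiber /=; [move/(pcan_inj choice.pickleK)|move=> ->].
  rewrite -integral_cst//; apply: eq_integral => w.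
  by rewrite inE /= => ->.
rewrite -(eq_esum (fun y _ => fiberE y)).
rewrite -(@esum_image _ _ _ [set: K] choice.pickle
  (fun n => \int[mu]_(w in fiber n) F (Y w))%E); last first.
  by move=> x y _ _; exact: (pcan_inj choice.pickleK).
rewrite [RHS]esum_mkcond; apply: eq_esum => n _; case: ifPn => // nK.
rewrite (_ : fiber n = set0) ?integral_set0//; apply/seteqP; split=> w //= h.
by move: nK; rewrite notin_setE; apply; exists (Y w).
Qed.

Lemma measure_countable (A : set K) :
  (mu (Y @^-1` A) = \esum_(y in A) mu (Y @^-1` [set y]))%E.
Proof.
have mA := measurable_preimage_countable A.
rewrite -[LHS]mul1e -[in LHS](setIT (Y @^-1` A)).
transitivity (\int[mu]_w (\1_A (Y w))%:E)%E.
  rewrite mul1e -(integral_indic mu measurableT mA).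
  by apply: eq_integral => w _; rewrite !indicE.
rewrite (@integral_countable (fun y => (\1_A y)%:E)) => [|y]; last first.
  by rewrite lee_fin.
rewrite [RHS]esum_mkcond; apply: eq_esum => y _; rewrite indicE.
by case: ifPn => _; rewrite ?mul1e ?mul0e.
Qed.

End countable_valued.

Section independence.
Context {d : measure_display} {Omega : measurableType d} {R : realType}.
Variables (P : probability Omega R) (lam : R) (E : set int)
  (Q : probability int R).
Variables (gap : nat -> {RV P >-> nat}) (V : nat -> {RV P >-> int}).
Hypothesis mbp : marked_binomial lam E Q gap V.
Hypothesis lam01 : 0 < lam < 1.

Local Notation slotv := (slotv gap V).
Local Notation slots := (slots gap V).
Local Notation pmf := (slot_law lam Q).
Local Notation L1 := (L1 P).
Local Notation L2 := (L2 P).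
Local Notation mean := (mean P).

Lemma slot_law_ge0 x : 0 <= pmf x.
Proof.
have /andP[l0 l1] := lam01; case: x => [k|] /=; last by rewrite subr_ge0 ltW.
by apply: mulr_ge0; [exact: ltW|exact: fine_ge0].
Qed.

Lemma measurable_slotv t x : measurable (slotv t.+1 @^-1` [set x]).
Proof.
have -> : slotv t.+1 = last None \o slots t.+1.
  by apply/funext => w; rewrite /comp slotsS last_rcons.
rewrite comp_preimage; apply: measurable_preimage_countable => o.
exact: (measurable_slots mbp).
Qed.

Let Z t w := (slots t w, slotv t.+1 w).

Let ZE t o x : Z t @^-1` [set (o, x)] = slots t.+1 @^-1` [set rcons o x].
Proof.
apply/seteqP; split=> w; rewrite /Z /= slotsS; first by move=> [-> ->].
by move/rcons_inj.
Qed.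

Let mZ t y : measurable (Z t @^-1` [set y]).
Proof. by case: y => o x; rewrite ZE; exact: (measurable_slots mbp). Qed.

Let prob_Z t o x : P (Z t @^-1` [set (o, x)]) =
  (P (slots t @^-1` [set o]) * (pmf x)%:E)%E.
Proof.
rewrite ZE !(prob_slots mbp) size_rcons eqSS; case: ifP => _.
  by rewrite -cats1 big_cat big_seq1 EFinM.
by rewrite mul0e.
Qed.

Lemma prob_slotv1 x : P (slotv 1 @^-1` [set x]) = (pmf x)%:E.
Proof.
rewrite (_ : _ @^-1` _ = slots 1 @^-1` [set [:: x]]).
  by rewrite (prob_slots mbp) /= big_seq1.
apply/seteqP; split=> w /=; first by move=> <-; exact: slotsS.
by rewrite (slotsS _ _ 0) => -[].
Qed.

(** Appending a slot multiplies the probability of a word by [pmf], so the past and the next slot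
    have a product law on atoms, and the double sum factors by Tonelli. *)
Lemma integral_slots_indep t (F : seq (option int) -> \bar R)
    (phi : option int -> \bar R) :
  (forall o, (0 <= F o)%E) -> (forall x, (0 <= phi x)%E) ->
  (\int[P]_w (F (slots t w) * phi (slotv t.+1 w)) =
   \int[P]_w F (slots t w) * \int[P]_w phi (slotv 1 w))%E.
Proof.
move=> F0 phi0.
have ms o : measurable (slots t @^-1` [set o]) by exact: (measurable_slots mbp).
have m1 x : measurable (slotv 1 @^-1` [set x]) by exact: measurable_slotv.
have p0 : (0 <= \int[P]_w phi (slotv 1 w))%E by exact: integral_ge0.
rewrite -ge0_integralZr//; last first.
  exact: (measurable_comp_countable ms F).
rewrite (@integral_countable _ _ _ _ _ (Z t) (mZ t)
  (fun y => F y.1 * phi y.2)%E) => [|y]; last exact: mule_ge0.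
rewrite (@integral_countable _ _ _ _ _ (slots t) ms
  (fun o => F o * \int[P]_w phi (slotv 1 w))%E) => [|y]; last exact: mule_ge0.
transitivity (\esum_(o in [set: seq (option int)])
   \esum_(x in [set: option int])
     ((F o * P (slots t @^-1` [set o])) * phi x * (pmf x)%:E))%E.
  rewrite esum_esum => [|o x _ _]; last first.
    by rewrite !mule_ge0// lee_fin slot_law_ge0.
  rewrite (_ : setXR _ _ = setT); last by apply/seteqP; split.
  by apply: eq_esum => -[s x] _; rewrite [X in (_ * X = _)%E]prob_Z /=;
    rewrite muleACA !muleA.
apply: eq_esum => o _.
have c0 : (0 <= F o * P (slots t @^-1` [set o]))%E by exact: mule_ge0.
rewrite muleAC -ge0_integralZl//; last first.
  exact: (measurable_comp_countable m1 phi).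
rewrite (@integral_countable _ _ _ _ _ (slotv 1) m1
  (fun x => F o * P (slots t @^-1` [set o]) * phi x)%E) => [|x]; last first.
  exact: mule_ge0.
by apply: eq_esum => x _; rewrite [X in (_ = _ * X)%E]prob_slotv1.
Qed.

(** Measurability with respect to the first [t] slots, in factored form. Words are countably many,
    so any [F] is allowed. *)
Definition adapted t (f : Omega -> R) : Prop :=
  exists F : seq (option int) -> R, f = F \o slots t.

Lemma measurable_adapted t f : adapted t f -> measurable_fun [set: Omega] f.
Proof.
move=> [F ->]; apply: measurable_comp_countable => o.
exact: (measurable_slots mbp).
Qed.

Lemma measurable_comp_slotv t (phi : option int -> R) :
  measurable_fun [set: Omega] (fun w => phi (slotv t.+1 w)).
Proof.
apply: (@measurable_comp_countable _ _ _ (slotv t.+1)); exact: measurable_slotv.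
Qed.

Lemma L1_indep t f (phi : option int -> R) : adapted t f -> L1 f ->
  L1 (fun w => phi (slotv 1 w)) -> L1 (fun w => f w * phi (slotv t.+1 w)).
Proof.
move=> af f1 phi1; apply/integrableP; split.
  apply/measurable_EFinP; apply: measurable_funM.
    exact: measurable_adapted af.
  exact: measurable_comp_slotv.
case: af f1 => F -> f1; under eq_integral do rewrite /= normrM EFinM.
rewrite (@integral_slots_indep t (fun o => `|F o|%:E) (fun x => `|phi x|%:E)) => [|o|x];
  [|by rewrite lee_fin..].
have /integrableP[_ f1y] := f1; have /integrableP[_ phi1y] := phi1.
by rewrite lte_mul_pinfty ?integral_ge0// ge0_fin_numE// integral_ge0.
Qed.

Let mean_indep_ge0 t F (phi : option int -> R) : L1 (F \o slots t) ->
  L1 (fun w => phi (slotv 1 w)) ->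
  (forall o, 0 <= F o) -> (forall x, 0 <= phi x) ->
  mean (fun w => F (slots t w) * phi (slotv t.+1 w)) =
  mean (F \o slots t) * mean (fun w => phi (slotv 1 w)).
Proof.
move=> f1 phi1 F0 phi0; apply: EFin_inj; rewrite EFinM -!integral_mean//.
  under eq_integral do rewrite EFinM.
  by rewrite (@integral_slots_indep t (EFin \o F) (EFin \o phi)) => [|o|x];
    [|rewrite lee_fin..].
by apply: (@L1_indep t (F \o slots t)) => //; exists F.
Qed.

Lemma mean_indep t f (phi : option int -> R) : adapted t f -> L1 f ->
  L1 (fun w => phi (slotv 1 w)) ->
  mean (fun w => f w * phi (slotv t.+1 w)) =
  mean f * mean (fun w => phi (slotv 1 w)).
Proof.
(* The nonnegative case extends to integrable functions by splitting both factors into positive and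
   negative parts. *)
pose pos (x : R) := 2^-1 * (`|x| + x); pose neg (x : R) := 2^-1 * (`|x| - x).
have pos0 x : 0 <= pos x.
  by rewrite mulr_ge0 ?invr_ge0// -lerBlDr sub0r -normrN ler_norm.
have neg0 x : 0 <= neg x.
  by rewrite mulr_ge0 ?invr_ge0// subr_ge0 ler_norm.
have posneg x : x = pos x - neg x by rewrite /pos /neg; field.
have L1abs g : L1 g -> L1 (fun w => `|g w|).
  exact: integrable_norm.
have L1pos g : L1 g -> L1 (fun w => pos (g w)).
  by move=> g1; apply: L1Z; apply: L1D => //; exact: L1abs.
have L1neg g : L1 g -> L1 (fun w => neg (g w)).
  by move=> g1; apply: L1Z; apply: L1B => //; exact: L1abs.
move=> [F ->] f1 phi1.
have L1M (G : R -> R) (psi : R -> R) : L1 (fun w => G (F (slots t w))) ->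
    L1 (fun w => psi (phi (slotv 1 w))) ->
    L1 (fun w => G (F (slots t w)) * psi (phi (slotv t.+1 w))).
  move=> G1 psi1; apply: (@L1_indep t (fun w => G (F (slots t w))) (psi \o phi)) => //.
  by exists (G \o F).
have EM (G : R -> R) (psi : R -> R) : (forall x, 0 <= G x) ->
    (forall x, 0 <= psi x) -> L1 (fun w => G (F (slots t w))) ->
    L1 (fun w => psi (phi (slotv 1 w))) ->
    mean (fun w => G (F (slots t w)) * psi (phi (slotv t.+1 w))) =
    mean (fun w => G (F (slots t w))) * mean (fun w => psi (phi (slotv 1 w))).
  by move=> G0 psi0 G1 psi1; apply: (@mean_indep_ge0 t (G \o F) (psi \o phi));
    [exact: G1|exact: psi1|move=> o; exact: G0|move=> x; exact: psi0].
have Fp := L1pos _ f1; have Fn := L1neg _ f1.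
have Pp := L1pos _ phi1; have Pn := L1neg _ phi1.
transitivity (mean (fun w =>
    (pos (F (slots t w)) * pos (phi (slotv t.+1 w)) +
     neg (F (slots t w)) * neg (phi (slotv t.+1 w))) -
    (pos (F (slots t w)) * neg (phi (slotv t.+1 w)) +
     neg (F (slots t w)) * pos (phi (slotv t.+1 w))))).
  congr mean; apply/funext => w /=.
  by rewrite {1}[F _]posneg {1}[phi _]posneg; ring.
rewrite meanB; [|by apply: L1D; exact: L1M|by apply: L1D; exact: L1M].
rewrite !meanD; [|exact: L1M..].
rewrite !EM//.
have -> : mean (F \o slots t) = mean (fun w => pos (F (slots t w))) -
    mean (fun w => neg (F (slots t w))).
  by rewrite -meanB//; congr mean; apply/funext => w /=; rewrite -posneg.
have -> : mean (fun w => phi (slotv 1 w)) = mean (fun w => pos (phi (slotv 1 w))) -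
    mean (fun w => neg (phi (slotv 1 w))).
  by rewrite -meanB//; congr mean; apply/funext => w /=; rewrite -posneg.
ring.
Qed.

Lemma adapted_cst t c : adapted t (fun=> c).
Proof. by exists (fun=> c). Qed.

Lemma adaptedD t f g : adapted t f -> adapted t g ->
  adapted t (fun w => f w + g w).
Proof. by move=> [F ->] [G ->]; exists (fun o => F o + G o). Qed.

Lemma adaptedM t f g : adapted t f -> adapted t g ->
  adapted t (fun w => f w * g w).
Proof. by move=> [F ->] [G ->]; exists (fun o => F o * G o). Qed.

Lemma adaptedS t f : adapted t f -> adapted t.+1 f.
Proof.
move=> [F ->]; exists (F \o take t); apply/funext => w /=.
by rewrite slotsS -cats1 take_size_cat// size_slots.
Qed.

Lemma adapted_slotv t (phi : option int -> R) :
  adapted t.+1 (fun w => phi (slotv t.+1 w)).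
Proof.
by exists (phi \o last None); apply/funext => w; rewrite /comp slotsS last_rcons.
Qed.

Lemma mean_slotv t (phi : option int -> R) : L1 (fun w => phi (slotv 1 w)) ->
  mean (fun w => phi (slotv t.+1 w)) = mean (fun w => phi (slotv 1 w)).
Proof.
move=> phi1; have := mean_indep (adapted_cst t 1) (L1_cst P 1) phi1.
rewrite mean_cst mul1r => <-; congr mean.
by apply/funext => w; rewrite mul1r.
Qed.

Lemma L2_indep t f (phi : option int -> R) : adapted t f -> L2 f ->
  L2 (fun w => phi (slotv 1 w)) -> L2 (fun w => f w * phi (slotv t.+1 w)).
Proof.
move=> af [mf f2] [mphi phi2]; split.
  by apply: measurable_funM => //; exact: measurable_comp_slotv.
rewrite (_ : (fun w => _) =
    (fun w => f w ^+ 2 * (phi (slotv t.+1 w)) ^+ 2)).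
  apply: (@L1_indep t (fun w => f w ^+ 2) (fun x => phi x ^+ 2)) => //.
  by apply: adaptedM.
by apply/funext => w; rewrite exprMn.
Qed.

Lemma mean_slotv_eq x :
  mean (fun w => (slotv 1 w == x)%:R) = pmf x.
Proof.
rewrite /mean (_ : (\int[P]_w _)%E = P (slotv 1 @^-1` [set x])).
  by rewrite prob_slotv1.
rewrite -[in RHS](setIT (slotv 1 @^-1` [set x])).
rewrite -(integral_indic P measurableT (measurable_slotv 0 x)).
apply: eq_integral => w _; rewrite indicE.
suff -> : (slotv 1 w == x) = (w \in slotv 1 @^-1` [set x]) by [].
by apply/idP/idP => [/eqP h|]; [exact: mem_set|rewrite inE => /eqP].
Qed.

End independence.

(** * Orthogonalized increments and chaos expansion *)

Section chaos_expansion.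
Context {d : measure_display} {Omega : measurableType d} {R : realType}.
Variables (P : probability Omega R) (lam : R) (E : set int)
  (Q : probability int R).
Variables (gap : nat -> {RV P >-> nat}) (V : nat -> {RV P >-> int}).
Variables (I : set nat) (e : nat -> int).
Hypothesis lam01 : 0 < lam < 1.
Hypothesis Q_gt0 : forall k, E k -> (0 < Q [set k])%E.
Hypothesis mbp : marked_binomial lam E Q gap V.
Hypothesis enumE : enumerates E I e.

Local Notation slotv := (slotv gap V).
Local Notation slots := (slots gap V).
Local Notation L1 := (L1 P).
Local Notation L2 := (L2 P).
Local Notation mean := (mean P).
Local Notation pmf := (slot_law lam Q).

Definition slot_mean (phi : option int -> R) : R :=
  mean (fun w => phi (slotv 1 w)).

(** Set to 0 outside [I], so that a finite [E] needs no separate treatment: there [incr] vanishes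
    and [rest_prob] is constant. *)
Definition mark_prob j : R := if `[< I j >] then pmf (Some (e j)) else 0.

Definition mark_ind j (x : option int) : R :=
  if `[< I j >] then (x == Some (e j))%:R else 0.

(** With indices starting at 0, this is [rho_(n+1)] of the overview. *)
Definition rest_prob n : R := 1 - \sum_(j < n) mark_prob j.

Definition rest_ind n x : R := 1 - \sum_(j < n) mark_ind j x.

Definition incr n x : R :=
  mark_ind n x - mark_prob n / rest_prob n * rest_ind n x.

(** The second moment [p (1 - p / rho)] of [incr n], see [slot_mean_sqr_incr]. *)
Definition incr_var n : R := mark_prob n * rest_prob n.+1 / rest_prob n.

Lemma rest_probS n : rest_prob n.+1 = rest_prob n - mark_prob n.
Proof. by rewrite /rest_prob big_ord_recr/= opprD addrA. Qed.

Lemma rest_indS n x : rest_ind n.+1 x = rest_ind n x - mark_ind n x.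
Proof. by rewrite /rest_ind big_ord_recr/= opprD addrA. Qed.

Lemma rest_ind_None n : rest_ind n None = 1.
Proof.
by rewrite /rest_ind big1 ?subr0// => j _; rewrite /mark_ind; case: ifP.
Qed.

Let e_inj i j : I i -> I j -> e i = e j -> i = j.
Proof. by move=> Ii Ij eij; case: enumE => _ [_ + _]; apply; rewrite ?inE. Qed.

Lemma mark_indM i j x :
  mark_ind i x * mark_ind j x = if i == j then mark_ind i x else 0.
Proof.
rewrite /mark_ind; have [<-|/eqP ij] := eqVneq i j.
  by case: ifP => _; rewrite ?mulr0// -natrM mulnb andbb.
case: ifPn => [/asboolP Ii|_]; last by rewrite mul0r.
case: ifPn => [/asboolP Ij|_]; last by rewrite mulr0.
case: eqVneq => [->|_]; last by rewrite mul0r.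
case: eqVneq => [[eij]|_]; last by rewrite mulr0.
by have := e_inj Ii Ij eij.
Qed.

Lemma mark_ind_rest i n x :
  mark_ind i x * rest_ind n x = if (i < n)%N then 0 else mark_ind i x.
Proof.
elim: n => [|n IH]; first by rewrite /rest_ind big_ord0 subr0 mulr1.
rewrite rest_indS mulrBr IH mark_indM ltnS [in RHS]leq_eqVlt.
by case: (eqVneq i n) => [->|_] /=; rewrite ?ltnn ?subrr ?subr0.
Qed.

Lemma rest_indM m n x : (m <= n)%N -> rest_ind m x * rest_ind n x = rest_ind n x.
Proof.
move=> mn; rewrite {1}/rest_ind mulrBl mul1r mulr_suml big1 ?subr0// => j _.
by rewrite mark_ind_rest (leq_trans (ltn_ord j) mn).
Qed.

Lemma rest_ind_ge0 n x : 0 <= rest_ind n x.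
Proof. by rewrite -(rest_indM x (leqnn n)) -expr2 sqr_ge0. Qed.

Lemma rest_ind_le1 n x : rest_ind n x <= 1.
Proof.
rewrite /rest_ind gerBl; apply: sumr_ge0 => j _; rewrite /mark_ind.
by case: ifP.
Qed.

Lemma norm_mark_ind n x : `|mark_ind n x| <= 1.
Proof. by rewrite /mark_ind; case: ifP => _; rewrite ?normr0// ger0_norm// lern1 leq_b1. Qed.

Lemma L2_slot_bounded c (phi : option int -> R) t : (forall x, `|phi x| <= c) ->
  L2 (fun w => phi (slotv t.+1 w)).
Proof.
move=> phic; apply: (@L2_bounded _ _ _ _ c) => //.
exact: (measurable_comp_slotv mbp).
Qed.

Lemma L2_mark_ind n : L2 (fun w => mark_ind n (slotv 1 w)).
Proof. by apply: (@L2_slot_bounded 1); exact: norm_mark_ind. Qed.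

Lemma L2_rest_ind n : L2 (fun w => rest_ind n (slotv 1 w)).
Proof.
apply: (@L2_slot_bounded 1) => x.
by rewrite ger0_norm ?rest_ind_ge0// rest_ind_le1.
Qed.

Let L1m n : L1 (fun w => mark_ind n (slotv 1 w)).
Proof. exact/L2_L1/L2_mark_ind. Qed.

Let L1r n : L1 (fun w => rest_ind n (slotv 1 w)).
Proof. exact/L2_L1/L2_rest_ind. Qed.

Lemma slot_mean_mark n : slot_mean (mark_ind n) = mark_prob n.
Proof.
rewrite /slot_mean /mark_ind /mark_prob; case: ifP => _; last exact: mean_cst.
exact: (mean_slotv_eq mbp).
Qed.

Lemma slot_mean_rest n : slot_mean (rest_ind n) = rest_prob n.
Proof.
elim: n => [|n IH].
  rewrite /slot_mean /rest_ind /rest_prob !big_ord0 subr0 -[RHS](mean_cst P 1).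
  by congr mean; apply/funext => w; rewrite big_ord0 subr0.
rewrite rest_probS -IH -slot_mean_mark -meanB//; congr mean.
by apply/funext => w; rewrite rest_indS.
Qed.

(** The empty slot belongs to the rest at every stage. *)
Lemma rest_prob_ge n : 1 - lam <= rest_prob n.
Proof.
rewrite -(_ : mean (fun w => (slotv 1 w == None)%:R) = 1 - lam); last first.
  exact: (mean_slotv_eq mbp None).
rewrite -slot_mean_rest; apply: mean_le => //.
  by apply/L2_L1/(@L2_slot_bounded 1 (fun x => (x == None)%:R)) => x;
    rewrite ger0_norm// lern1 leq_b1.
move=> w; case: eqVneq => [->|_]; first by rewrite rest_ind_None.
exact: rest_ind_ge0.
Qed.

Lemma rest_prob_gt0 n : 0 < rest_prob n.
Proof. by apply: lt_le_trans (rest_prob_ge n); have /andP[] := lam01; lra. Qed.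

Lemma mark_prob_ge0 n : 0 <= mark_prob n.
Proof. by rewrite /mark_prob; case: ifP => // _; exact: slot_law_ge0. Qed.

Lemma mark_prob_gt0 n : I n -> 0 < mark_prob n.
Proof.
move=> In; rewrite /mark_prob asboolT//=; have /andP[l0 _] := lam01.
rewrite mulr_gt0// fine_gt0// Q_gt0 ?ltey_eq ?fin_num_measure//=.
by case: enumE => _ [+ _ _]; exact.
Qed.

Lemma rest_prob_le1 n : rest_prob n <= 1.
Proof. by rewrite /rest_prob gerBl; apply: sumr_ge0 => j _; exact: mark_prob_ge0. Qed.

(** Residual masses lie between [1 - lam] and 1. Together with [incr_var_le], this makes the norms
    weighted by variances and by intensities equivalent. *)
Lemma incr_var_ge n : (1 - lam) * mark_prob n <= incr_var n.
Proof.
have r0 := rest_prob_gt0 n; have r1 := rest_prob_le1 n.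
have r' := rest_prob_ge n.+1; have p0 := mark_prob_ge0 n.
rewrite /incr_var ler_pdivlMr// [X in _ <= X]mulrC -mulrA [mark_prob n * _]mulrC mulrA.
apply: ler_wpM2r => //; apply: le_trans r'; rewrite ler_piMr//.
by have /andP[] := lam01; lra.
Qed.

Lemma incr_var_le n : incr_var n <= mark_prob n.
Proof.
have r0 := rest_prob_gt0 n; have p0 := mark_prob_ge0 n.
rewrite /incr_var ler_pdivrMr//; apply: ler_wpM2l => //.
by rewrite rest_probS gerBl.
Qed.

Lemma incr_var_ge0 n : 0 <= incr_var n.
Proof.
apply: le_trans (incr_var_ge n); rewrite mulr_ge0 ?mark_prob_ge0//.
by have /andP[] := lam01; lra.
Qed.

Lemma incr_var_gt0 n : I n -> 0 < incr_var n.
Proof.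
move=> In; apply: lt_le_trans (incr_var_ge n); rewrite mulr_gt0 ?mark_prob_gt0//.
by have /andP[] := lam01; lra.
Qed.

(** Products of the nested indicators collapse to combinations of [mark_ind n] and [rest_ind n], so
    the moments of the increments are all computed through this formula. *)
Lemma slot_mean_lin n a b phi : (forall x, phi x = a * mark_ind n x + b * rest_ind n x) ->
  slot_mean phi = a * mark_prob n + b * rest_prob n.
Proof.
move=> phiE; rewrite -slot_mean_mark -slot_mean_rest /slot_mean -!meanZ//.
rewrite -meanD; [|exact: L1Z..].
by congr mean; apply/funext => w; rewrite phiE.
Qed.

Lemma slot_mean_incr n : slot_mean (incr n) = 0.
Proof.
rewrite (@slot_mean_lin n 1 (- (mark_prob n / rest_prob n))) => [|x].
  by field; rewrite gt_eqF ?rest_prob_gt0.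
by rewrite /incr; ring.
Qed.

Lemma mark_ind_incr i n x : (n < i)%N ->
  mark_ind i x * incr n x = - (mark_prob n / rest_prob n) * mark_ind i x.
Proof.
move=> ni; rewrite /incr mulrBr mark_indM gtn_eqF//.
rewrite mulrCA mark_ind_rest ltnNge (ltnW ni)/=; ring.
Qed.

Lemma slot_mean_sqr_incr n : slot_mean (fun x => incr n x ^+ 2) = incr_var n.
Proof.
pose c := mark_prob n / rest_prob n.
rewrite (@slot_mean_lin n (1 - 2 * c) (c ^+ 2)) => [|x].
  by rewrite /incr_var rest_probS /c; field; rewrite gt_eqF ?rest_prob_gt0.
rewrite /incr -/c.
have := mark_indM n n x; rewrite eqxx => h1.
have := rest_indM x (leqnn n) => h2.
have := mark_ind_rest n n x; rewrite ltnn => h3.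
rewrite sqrrB exprMn !expr2 h1 h2 mulrCA h3; ring.
Qed.

(** For [i < n], [incr i] is constant on the support of [incr n], with value
    [- mark_prob i / rest_prob i], and [incr n] is centered. *)
Lemma slot_mean_incrM i n : i != n -> slot_mean (fun x => incr i x * incr n x) = 0.
Proof.
wlog : i n / (i < n)%N => [wl|ni _].
  rewrite neq_ltn => /orP[|ni]; first by move=> lin; apply: wl => //; rewrite ltn_eqF.
  rewrite (_ : (fun x => _) = (fun x => incr n x * incr i x)).
    by apply: wl => //; rewrite ltn_eqF.
  by apply/funext => x; rewrite mulrC.
pose c j := mark_prob j / rest_prob j.
rewrite (@slot_mean_lin n (- c i) (c i * c n)) => [|x].
  by rewrite /c; field; rewrite !gt_eqF ?rest_prob_gt0.
rewrite /incr -/(c i) -/(c n).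
have h1 := mark_indM i n x; rewrite ltn_eqF// in h1.
have h2 := rest_indM x (ltnW ni).
have h3 := mark_ind_rest i n x; rewrite ni in h3.
have h4 := mark_ind_rest n i x; rewrite ltnNge (ltnW ni) /= in h4.
transitivity (mark_ind i x * mark_ind n x - c n * (mark_ind i x * rest_ind n x)
  - c i * (mark_ind n x * rest_ind i x) + c i * c n * (rest_ind i x * rest_ind n x)).
  by ring.
rewrite h1 h2 h3 h4; ring.
Qed.

Lemma norm_incr n x : `|incr n x| <= 2.
Proof.
have r0 := rest_prob_gt0 n; have p0 := mark_prob_ge0 n.
have c1 : mark_prob n / rest_prob n <= 1.
  rewrite ler_pdivrMr// mul1r -subr_ge0 -rest_probS.
  exact/ltW/rest_prob_gt0.
have c0 : 0 <= mark_prob n / rest_prob n by rewrite divr_ge0// ltW.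
rewrite /incr; apply: le_trans (ler_normB _ _) _.
have h1 := rest_ind_le1 n x; have h0 := rest_ind_ge0 n x.
have ch0 : 0 <= mark_prob n / rest_prob n * rest_ind n x by exact: mulr_ge0.
have ch1 : mark_prob n / rest_prob n * rest_ind n x <= 1.
  by apply: le_trans h1; rewrite ler_piMl.
by rewrite (ger0_norm ch0); have := norm_mark_ind n x; lra.
Qed.

Lemma L2_incr n t : L2 (fun w => incr n (slotv t.+1 w)).
Proof. by apply: (@L2_slot_bounded 2); exact: norm_incr. Qed.

(** Telescoping: [rest_ind j / rest_prob j] drops by exactly [incr j / rest_prob j.+1] when mark [j]
    is resolved. *)
Lemma sum_incr n x :
  \sum_(j < n) incr j x / rest_prob j.+1 = 1 - rest_ind n x / rest_prob n.
Proof.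
elim: n => [|n IH].
  by rewrite big_ord0 /rest_ind /rest_prob !big_ord0 subr0 divr1 subrr.
rewrite big_ord_recr/= IH rest_indS /incr.
have := rest_prob_gt0 n; have := rest_prob_gt0 n.+1; rewrite rest_probS => h1 h2.
field; by rewrite !gt_eqF.
Qed.

Let slotvP t w k : slotv t w = Some k <-> eta gap V w (t, k).
Proof. apply: slotv_Some; exact: (gap_gt0 mbp). Qed.

Lemma indic_point t k :
  \1_(Defs.point gap V t k) = (fun w => (slotv t w == Some k)%:R) :> (Omega -> R).
Proof.
apply/funext => w; rewrite indicE.
suff -> : (w \in Defs.point gap V t k) = (slotv t w == Some k) by [].
by apply/idP/eqP => [|/slotvP h]; [rewrite inE => /slotvP|exact: mem_set].
Qed.

Lemma dZE t n w : I n -> dZ lam Q gap V t (e n) w =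
  mark_ind n (slotv t w) - mark_prob n.
Proof. by move=> In; rewrite /dZ indic_point /mark_ind /mark_prob asboolT. Qed.

(** On mark [n], the earlier [incr i] is constant, which gives the numerator. The coefficient
    depends on [n] only through the factor [mark_prob n], so the Gram-Schmidt correction is a
    multiple of the sum in [sum_incr]. *)
Lemma gammaE i n : (i < n)%N -> I n ->
  gamma P lam Q gap V (e n) (fun t w => incr i (slotv t w)) =
  - (mark_prob n / rest_prob i.+1).
Proof.
move=> lin In; have Ii : I i by case: enumE => Il _; exact: Il lin In.
rewrite /gamma.
have -> : fine 'E_P[fun w => incr i (slotv 1 w) ^+ 2] = incr_var i.
  by rewrite -slot_mean_sqr_incr unlock.
have -> : fine 'E_P[fun w => dZ lam Q gap V 1 (e n) w * incr i (slotv 1 w)] =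
    - (mark_prob i / rest_prob i) * mark_prob n.
  rewrite unlock; transitivity (slot_mean
      (fun x => mark_ind n x * incr i x - mark_prob n * incr i x)).
    by congr mean; apply/funext => w; rewrite dZE// mulrBl.
  have ci1 : L1 (fun w => incr i (slotv 1 w)) by exact/L2_L1/L2_incr.
  rewrite /slot_mean meanB; [|exact/L2M/L2_incr/L2_mark_ind|exact: L1Z].
  rewrite meanZ//; have := slot_mean_incr i; rewrite /slot_mean => ->.
  rewrite mulr0 subr0 -(slot_mean_mark n) /slot_mean -meanZ//.
  by congr mean; apply/funext => w; rewrite mark_ind_incr.
rewrite /incr_var; have := mark_prob_gt0 Ii.
have := rest_prob_gt0 i; have := rest_prob_gt0 i.+1 => h1 h2 h3.
by field; rewrite !gt_eqF.
Qed.

Lemma dR_seqE n : (forall j, (j < n)%N -> I j) ->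
  dR_seq P lam Q gap V e n = mkseq (fun j t w => incr j (slotv t w)) n.
Proof.
elim: n => [//|n IH] In; rewrite mkseqS /= IH => [|j jn]; last exact/In/ltnW.
congr rcons; apply/funext => t; apply/funext => w.
have Inn : I n by exact: In.
rewrite /mkseq; have <- : index_iota 0 n = iota 0 n by rewrite /index_iota subn0.
rewrite dZE// big_map big_mkord.
under eq_bigr => j _ do rewrite gammaE//.
transitivity (mark_ind n (slotv t w) - mark_prob n +
  mark_prob n * \sum_(j < n) incr j (slotv t w) / rest_prob j.+1).
  congr (_ + _); rewrite mulr_sumr -sumrN; apply: eq_bigr => j _.
  by rewrite mulNr opprK mulrAC mulrA.
by rewrite sum_incr /incr; ring.
Qed.

Lemma dRE t n w : I n -> dR P lam Q gap V e t n w = incr n (slotv t w).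
Proof.
move=> In; rewrite /dR dR_seqE; first by rewrite nth_mkseq.
move=> j; rewrite ltnS leq_eqVlt => /predU1P[->//|jn].
by case: enumE => Il _; exact: Il jn In.
Qed.

Lemma norm_sqr_rest n (y : R) x : `|y ^+ 2 * rest_ind n x| <= y ^+ 2.
Proof.
rewrite normrM ger0_norm ?sqr_ge0// ger0_norm ?rest_ind_ge0//.
by rewrite ler_piMr ?sqr_ge0// rest_ind_le1.
Qed.

Lemma L1_sqr_rest (phi : option int -> R) n :
  L2 (fun w => phi (slotv 1 w)) ->
  L1 (fun w => phi (slotv 1 w) ^+ 2 * rest_ind n (slotv 1 w)).
Proof.
move=> [_ phi21]; apply: L1_le phi21.
  exact: (measurable_comp_slotv mbp 0 (fun x => phi x ^+ 2 * rest_ind n x)).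
by move=> w; exact: norm_sqr_rest.
Qed.

(** A marked slot leaves the rest once the enumeration has passed its mark, and [phi] vanishes on
    the empty slot, which never leaves; dominated convergence concludes. *)
Lemma rest_sqr_cvg0 (phi : option int -> R) eps :
  L2 (fun w => phi (slotv 1 w)) -> phi None = 0 -> 0 < eps ->
  exists N, slot_mean (fun x => phi x ^+ 2 * rest_ind N x) < eps.
Proof.
move=> phi2 phi0 eps0; pose D n x := phi x ^+ 2 * rest_ind n x.
have mD n : measurable_fun [set: Omega] (fun w => (D n (slotv 1 w))%:E).
  exact: measurable_int (L1_sqr_rest n phi2).
have gi : P.-integrable [set: Omega]
    (fun w => (phi (slotv 1 w) ^+ 2)%:E) by case: phi2.
have cv : {ae P, forall w, [set: Omega] w ->
    (fun n => (D n (slotv 1 w))%:E) @ \oo --> 0%E}.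
  apply: aeW => w _; apply: cvg_near_cst.
  case sw : (slotv 1 w) => [k|]; last first.
    by apply: nearW => n; rewrite /D phi0 expr0n/= mul0r.
  have Ek : E k.
    move/(slotv_Some V (gap_gt0 mbp)) : sw => [i [_ /= Vk]].
    by rewrite -Vk; exact: (mark_in mbp).
  have [j Ij jk] : (e @` I) k by case: enumE => _ [_ _]; apply.
  exists j.+1 => // n /= jn; rewrite /D (_ : rest_ind n _ = 0) ?mulr0//.
  have := mark_ind_rest j n (Some k).
  by rewrite {1}/mark_ind asboolT// jk eqxx mul1r jn.
have bd : {ae P, forall w n, [set: Omega] w ->
    (`|(D n (slotv 1 w))%:E| <= (phi (slotv 1 w) ^+ 2)%:E)%E}.
  by apply: aeW => w n _; rewrite lee_fin; exact: norm_sqr_rest.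
have [_ _] := dominated_convergence measurableT mD
  (measurable_cst 0%E) cv gi bd.
rewrite integral0 => /fine_cvgP[_ /cvgr0Pnorm_lt /(_ _ eps0)[N _ /(_ N (leqnn N))]].
by move=> /(le_lt_trans (ler_norm _)) lN; exists N.
Qed.

(** * Expansion of a function of one slot *)

Section projection.
Variable G : option int -> R.
Hypothesis G2 : L2 (fun w => G (slotv 1 w)).

Definition rest_mean n : R := slot_mean (fun x => G x * rest_ind n x).

(** The value of [G] at mark [n] minus its average over what remains after that mark;
    [slot_mean_proj] shows that it is the coefficient of [G] on [incr n]. *)
Definition proj_coef n : R :=
  G (Some (e n)) - rest_mean n.+1 / rest_prob n.+1.

Let GmarkE n x : G x * mark_ind n x = G (Some (e n)) * mark_ind n x.
Proof.
rewrite /mark_ind; case: ifP => _; last by rewrite !mulr0.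
by case: eqVneq => [->//|_]; rewrite !mulr0.
Qed.

Let L1G_rest n : L1 (fun w => G (slotv 1 w) * rest_ind n (slotv 1 w)).
Proof. by apply: L2M => //; exact: L2_rest_ind. Qed.

Let L1_mark n : L1 (fun w => mark_ind n (slotv 1 w)).
Proof. by apply: L2_L1; exact: L2_mark_ind. Qed.

Lemma rest_meanS n :
  rest_mean n.+1 = rest_mean n - mark_prob n * G (Some (e n)).
Proof.
rewrite /rest_mean /slot_mean mulrC -(slot_mean_mark n) /slot_mean.
rewrite -meanZ// -meanB//; last exact: L1Z.
by congr mean; apply/funext => w; rewrite rest_indS mulrBr GmarkE.
Qed.

Lemma slot_mean_proj n :
  slot_mean (fun x => G x * incr n x) = proj_coef n * incr_var n.
Proof.
pose c := mark_prob n / rest_prob n.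
transitivity (G (Some (e n)) * mark_prob n - c * rest_mean n).
  rewrite -(slot_mean_mark n) /rest_mean /slot_mean -!meanZ//.
  rewrite -meanB; [|exact: L1Z..].
  by congr mean; apply/funext => w; rewrite /incr -/c mulrBr GmarkE mulrCA.
rewrite {}/c.
rewrite /proj_coef /incr_var rest_meanS.
have := rest_prob_gt0 n.
have := rest_prob_gt0 n.+1; rewrite rest_probS => h1 h2.
by field; rewrite !gt_eqF.
Qed.

Hypothesis G0 : slot_mean G = 0.

Let L1G2_rest n : L1 (fun w => G (slotv 1 w) ^+ 2 * rest_ind n (slotv 1 w)).
Proof. exact: L1_sqr_rest. Qed.

(** What [n] increments leave of the norm of [G] is its unnormalized variance on the unresolved
    event. Centering of [G] serves at [n = 0], where this event is everything. *)
Let bessel_identity n : slot_mean (fun x => G x ^+ 2)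
    - \sum_(j < n) proj_coef j ^+ 2 * incr_var j =
  slot_mean (fun x => G x ^+ 2 * rest_ind n x) - rest_mean n ^+ 2 / rest_prob n.
Proof.
elim: n => [|n IH].
  rewrite big_ord0 subr0 /rest_prob big_ord0 subr0 divr1.
  rewrite (_ : rest_mean 0 = 0) ?expr0n/= ?subr0.
    congr mean; apply/funext => w; rewrite /rest_ind big_ord0; ring.
  rewrite -G0; congr mean; apply/funext => w; rewrite /rest_ind big_ord0; ring.
rewrite big_ord_recr/= opprD addrA IH.
have -> : slot_mean (fun x => G x ^+ 2 * rest_ind n.+1 x) =
    slot_mean (fun x => G x ^+ 2 * rest_ind n x) - G (Some (e n)) ^+ 2 * mark_prob n.
  rewrite -(slot_mean_mark n) /slot_mean -!meanZ//.
  rewrite -meanB; [|exact: L1G2_rest|exact: L1Z].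
  congr mean; apply/funext => w; rewrite rest_indS mulrBr; congr (_ - _).
  have h := GmarkE n (slotv 1 w); set m := mark_ind _ _ in h *.
  transitivity (G (slotv 1 w) * (G (slotv 1 w) * m)); first by ring.
  rewrite h; transitivity (G (Some (e n)) * (G (slotv 1 w) * m)); first by ring.
  by rewrite h; ring.
rewrite /proj_coef /incr_var rest_meanS.
have := rest_prob_gt0 n.
have := rest_prob_gt0 n.+1; rewrite rest_probS => h1 h2.
by field; rewrite !gt_eqF.
Qed.

(** The remaining variance is the mean of [(G - c)^2] on the rest, [c] being the average of [G]
    there. *)
Lemma bessel_slot n : \sum_(j < n) proj_coef j ^+ 2 * incr_var j <=
  slot_mean (fun x => G x ^+ 2).
Proof.
rewrite -subr_ge0 bessel_identity.
pose c := rest_mean n / rest_prob n.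
have r0 := rest_prob_gt0 n.
have G21 : L1 (fun w => G (slotv 1 w) ^+ 2) by case: G2.
rewrite (_ : _ - _ = slot_mean (fun x => (G x - c) ^+ 2 * rest_ind n x)).
  by apply: mean_ge0 => w; rewrite mulr_ge0 ?sqr_ge0 ?rest_ind_ge0.
rewrite (_ : slot_mean (fun x => (G x - c) ^+ 2 * rest_ind n x) =
  slot_mean (fun x => G x ^+ 2 * rest_ind n x)
      - (2 * c) * rest_mean n + c ^+ 2 * rest_prob n).
  by rewrite /c; field; rewrite gt_eqF.
rewrite -slot_mean_rest /rest_mean /slot_mean -!meanZ//.
rewrite -meanB; [|exact: L1G2_rest|exact: L1Z].
rewrite -meanD; [|by apply: L1B; [exact: L1G2_rest|exact: L1Z]|exact: L1Z].
by congr mean; apply/funext => w; ring.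
Qed.

(* The best constant approximation of G on the unresolved part of the mark
   space is its mean there; comparing with the value of G on the empty slot
   makes the error a dominated integral that vanishes in the limit. *)
Lemma parseval_slot eps : 0 < eps -> exists N,
  slot_mean (fun x => G x ^+ 2) < \sum_(j < N) proj_coef j ^+ 2 * incr_var j + eps.
Proof.
move=> eps0; pose D n x := (G x - G None) ^+ 2 * rest_ind n x.
have GB2 : L2 (fun w => (fun x => G x - G None) (slotv 1 w)).
  by apply: L2B => //; exact: L2_cst.
have le_D n : slot_mean (fun x => G x ^+ 2) -
    \sum_(j < n) proj_coef j ^+ 2 * incr_var j <= slot_mean (D n).
  rewrite bessel_identity.
  have -> : slot_mean (D n) = slot_mean (fun x => G x ^+ 2 * rest_ind n x)
      - (2 * G None) * rest_mean n + G None ^+ 2 * rest_prob n.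
    rewrite -slot_mean_rest /rest_mean /slot_mean -!meanZ//.
    rewrite -meanB; [|exact: L1G2_rest|exact: L1Z].
    rewrite -meanD; [|by apply: L1B; [exact: L1G2_rest|exact: L1Z]|exact: L1Z].
    by congr mean; apply/funext => w; rewrite /D; ring.
  rewrite -addrA lerD2l -subr_ge0.
  have r0 := rest_prob_gt0 n.
  rewrite (_ : _ - _ = (G None * rest_prob n - rest_mean n) ^+ 2 / rest_prob n).
    by rewrite divr_ge0 ?sqr_ge0// ltW.
  by field; rewrite gt_eqF.
have [N DN] := @rest_sqr_cvg0 (fun x => G x - G None) _ GB2 (subrr _) eps0.
by exists N; rewrite addrC -ltrBlDr (le_lt_trans (le_D N)).
Qed.

End projection.

(** [increasing] with a bound on times, for induction on [t], and with [pairwise] instead of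
    [sorted], so that the last point splits off. *)
Definition chronological t (s : seq (nat * nat)) : Prop :=
  pairwise ltn (unzip1 s) /\
  forall p, p \in s -> (0 < p.1 <= t)%N /\ I p.2.

Lemma chronological_nil t : chronological t [::].
Proof. by split. Qed.

Lemma chronological0 s : chronological 0 s -> s = [::].
Proof.
case: s => [//|p s [_ /(_ p (mem_head _ _))[]]].
by rewrite lt0n leqn0 andNb.
Qed.

Lemma chronological_le t t' s : (t <= t')%N -> chronological t s ->
  chronological t' s.
Proof.
by move=> tt' [ps sP]; split=> // p /sP[/andP[-> /leq_trans->]].
Qed.

Lemma chronological_rcons t s j : chronological t s -> I j ->
  chronological t.+1 (rcons s (t.+1, j)).
Proof.
move=> [ps sP] Ij; split.
  rewrite /unzip1 map_rcons pairwise_rcons ps andbT; apply/allP => _ /mapP[p ps' ->].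
  by have [/andP[_]] := sP _ ps'.
move=> p; rewrite mem_rcons in_cons => /predU1P[->|/sP[/andP[p0 pt] Ip]].
  by rewrite /= leqnn.
by rewrite p0 (leq_trans pt).
Qed.

(** At most one point sits at time [t.+1], and it comes last. This dichotomy matches the recursion
    of [elem_sym] and drives the inductions on time. *)
Lemma chronologicalS t s : chronological t.+1 s ->
  chronological t s \/
  exists s1 j, [/\ s = rcons s1 (t.+1, j), chronological t s1 & I j].
Proof.
case/lastP: s => [_|s [v j]]; first by left; exact: chronological_nil.
rewrite /chronological /unzip1 map_rcons pairwise_rcons => -[/andP[/allP su ps] sP].
have lt_v p : p \in s -> (p.1 < v)%N by move=> ps'; apply: su; exact: map_f.
have {}sP' p : p \in s -> (0 < p.1)%N /\ I p.2.
  move=> ps'; have [|/andP[]] := sP p; last by [].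
  by rewrite mem_rcons in_cons ps' orbT.
have [|/andP[v0 vt] Ij] := sP (v, j); first by rewrite mem_rcons mem_head.
move: vt; rewrite /= leq_eqVlt ltnS => /predU1P[vt|vt].
  right; exists s, j; split=> //; first by rewrite vt.
  split=> // p ps'; have [p0 Ip] := sP' p ps'.
  by split=> //; rewrite p0 -ltnS -vt lt_v.
left; split.
  by rewrite ?map_rcons ?pairwise_rcons ps andbT; exact/allP.
move=> p; rewrite mem_rcons in_cons => /predU1P[->|ps']; first by rewrite v0.
have [p0 Ip] := sP' p ps'.
by split=> //; rewrite p0 (leq_trans (ltnW (lt_v p ps'))).
Qed.

Lemma increasing_chronological n (s : n.-tuple (nat * nat)) :
  increasing I s -> exists t, chronological t s.
Proof.
move=> [ss sP]; exists (\max_(p <- s) p.1)%N; split.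
  by rewrite -(sorted_pairwise ltn_trans).
by move=> p ps; have [p0 Ip] := sP p ps; rewrite p0 leq_bigmax_seq.
Qed.

Lemma chronological_increasing n t (s : n.-tuple (nat * nat)) :
  chronological t s -> increasing I s.
Proof.
move=> [ps sP]; split; first by rewrite (sorted_pairwise ltn_trans).
by move=> p /sP[/andP[]].
Qed.

(** * Orthogonality of products of increments *)

Section kernel.
Variable h : nat -> int -> R.

Definition chaos_term (s : seq (nat * nat)) (w : Omega) : R :=
  \prod_(p <- s) (h p.1 (e p.2) * incr p.2 (slotv p.1 w)).

Definition chaos_var (s : seq (nat * nat)) : R :=
  \prod_(p <- s) (h p.1 (e p.2) ^+ 2 * incr_var p.2).

Lemma chaos_term_rcons s p w : chaos_term (rcons s p) w =
  chaos_term s w * (h p.1 (e p.2) * incr p.2 (slotv p.1 w)).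
Proof. by rewrite /chaos_term -cats1 big_cat big_seq1. Qed.

Lemma chaos_var_rcons s p : chaos_var (rcons s p) =
  chaos_var s * (h p.1 (e p.2) ^+ 2 * incr_var p.2).
Proof. by rewrite /chaos_var -cats1 big_cat big_seq1. Qed.

Let L2_factor c j : L2 (fun w => c * incr j (slotv 1 w)).
Proof. exact/L2Z/L2_incr. Qed.

Let mean_factor c j : mean (fun w => c * incr j (slotv 1 w)) = 0.
Proof.
rewrite meanZ; last exact/L2_L1/L2_incr.
by have := slot_mean_incr j; rewrite /slot_mean => ->; rewrite mulr0.
Qed.

Lemma chaos_term_adapted t s : chronological t s ->
  adapted gap V t (chaos_term s) /\ L2 (chaos_term s).
Proof.
elim: t s => [|t IH] s.
  move=> /chronological0 ->; rewrite (_ : chaos_term [::] = fun=> 1).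
    by split; [exact: adapted_cst|exact: L2_cst].
  by apply/funext => w; rewrite /chaos_term big_nil.
case/chronologicalS => [/IH[as_ s2]|[s1 [j [-> /IH[as1 s2] Ij]]]].
  by split=> //; exact: adaptedS.
pose phi x := h t.+1 (e j) * incr j x.
rewrite (_ : chaos_term _ = fun w => chaos_term s1 w * phi (slotv t.+1 w)).
  split; first by apply: adaptedM; [exact: adaptedS|exact: adapted_slotv].
  by apply: (L2_indep mbp lam01) => //; exact: L2_factor.
by apply/funext => w; rewrite chaos_term_rcons.
Qed.

(* A factor at a time later than everything else has mean zero. *)
Let mean_last t s j f : chronological t s -> adapted gap V t f -> L2 f ->
  mean (fun w => f w * chaos_term (rcons s (t.+1, j)) w) = 0.
Proof.
move=> /chaos_term_adapted[as_ s2] af f2.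
pose phi x := h t.+1 (e j) * incr j x.
rewrite (_ : (fun w => _) = fun w => f w * chaos_term s w * phi (slotv t.+1 w)).
  rewrite (mean_indep mbp lam01 (adaptedM af as_)).
  - by rewrite mean_factor mulr0.
  - exact: L2M.
  - exact/L2_L1/L2_factor.
by apply/funext => w; rewrite chaos_term_rcons /= mulrA.
Qed.

(** Induction on the last time. A point at [t.+1] in one sequence only gives mean zero; when both
    have one, the last factors split off by independence and [slot_mean_incrM] forces equal
    marks. *)
Lemma mean_chaos_termM t s s' : chronological t s -> chronological t s' ->
  mean (fun w => chaos_term s w * chaos_term s' w) =
  if s == s' then chaos_var s else 0.
Proof.
elim: t s s' => [|t IH] s s'.
  move=> /chronological0 -> /chronological0 ->.
  rewrite eqxx /chaos_var big_nil -[RHS](mean_cst P 1); congr mean.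
  by apply/funext => w; rewrite /chaos_term big_nil mulr1.
have ltP s1 j s2 : chronological t s1 -> chronological t s2 ->
    (rcons s1 (t.+1, j) == s2) = false.
  move=> _ [_ s2P]; apply/eqP => s12; have := s2P (t.+1, j).
  by rewrite -s12 mem_rcons mem_head => /(_ isT)[]; rewrite /= ltnn.
case/chronologicalS => [cs|[s1 [j [-> cs Ij]]]];
  case/chronologicalS => [cs'|[s1' [j' [-> cs' Ij']]]].
- exact: IH.
- have [as_ s2] := chaos_term_adapted cs.
  by rewrite mean_last// eq_sym ltP.
- have [as_ s2] := chaos_term_adapted cs'.
  rewrite ltP// -[RHS](mean_last j cs as_ s2); congr mean.
  by apply/funext => w; rewrite mulrC.
have [a1 s2] := chaos_term_adapted cs; have [a1' s2'] := chaos_term_adapted cs'.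
pose phi x := h t.+1 (e j) * h t.+1 (e j') * (incr j x * incr j' x).
rewrite (_ : (fun w => _) = fun w =>
    chaos_term s1 w * chaos_term s1' w * phi (slotv t.+1 w)); last first.
  by apply/funext => w; rewrite !chaos_term_rcons /phi/=; ring.
rewrite (mean_indep mbp lam01 (adaptedM a1 a1')) ?IH//; [|exact: L2M|]; last first.
  by apply: L1Z; apply: L2M; exact: L2_incr.
rewrite (_ : mean _ = h t.+1 (e j) * h t.+1 (e j') *
    slot_mean (fun x => incr j x * incr j' x)); last first.
  by rewrite meanZ//; apply: L2M; exact: L2_incr.
rewrite eqseq_rcons xpair_eqE eqxx /=.
have [->|jj'] := eqVneq j j'; last by rewrite slot_mean_incrM// andbF !mulr0.
rewrite andbT; case: eqP => [->|_]; last by rewrite mul0r.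
rewrite chaos_var_rcons /= -slot_mean_sqr_incr; congr (_ * _).
Qed.

Lemma chaos_term_sqr t s : chronological t s ->
  mean (fun w => chaos_term s w ^+ 2) = chaos_var s.
Proof. by move=> cs; have := mean_chaos_termM cs cs; rewrite eqxx. Qed.

End kernel.

(** * Elementary symmetric functions of the slots *)

Section elementary_symmetric.
Variable G : option int -> R.
Hypothesis G2 : L2 (fun w => G (slotv 1 w)).
Hypothesis G0 : slot_mean G = 0.

Fixpoint elem_sym t n (w : Omega) : R :=
  if n is n'.+1 then
    if t is t'.+1 then elem_sym t' n w + elem_sym t' n' w * G (slotv t w) else 0
  else 1.

(** Its value is ['C(t, n) * c ^+ n]; the recursive form unfolds in step with [elem_sym] and
    [chron_tuples]. *)
Fixpoint elem_sym_cst (c : R) t n : R :=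
  if n is n'.+1 then
    if t is t'.+1 then elem_sym_cst c t' n + elem_sym_cst c t' n' * c else 0
  else 1.

Lemma elem_sym_gt t n w : (t < n)%N -> elem_sym t n w = 0.
Proof.
elim: t n => [|t IH] [|n]//= tn.
by rewrite !IH ?mul0r ?addr0// ltnW.
Qed.

Lemma sum_elem_sym t w :
  \sum_(n < t.+1) elem_sym t n w = \prod_(s < t) (1 + G (slotv s.+1 w)).
Proof.
elim: t => [|t IH]; first by rewrite big_ord0 big_ord_recl big_ord0 addr0.
rewrite [in RHS]big_ord_recr/= -IH mulrDr mulr1 mulr_suml [LHS]big_ord_recl/=.
rewrite [X in X + _ = _](_ : 1 = elem_sym t 0 w); last by case: t {IH}.
under eq_bigr do rewrite /bump/= add1n.
rewrite big_split/= addrA; congr (_ + _).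
rewrite big_ord_recr/= (elem_sym_gt w (ltnSn t)) addr0.
by rewrite [RHS]big_ord_recl; congr (_ + _).
Qed.

Lemma elem_sym_adapted t n : adapted gap V t (elem_sym t n) /\ L2 (elem_sym t n).
Proof.
elim: t n => [|t IH] [|n].
- by split; [exact: adapted_cst|exact: L2_cst].
- by split; [exact: adapted_cst|exact: L2_cst].
- by split; [exact: adapted_cst|exact: L2_cst].
have [an n2] := IH n; have [aS S2] := IH n.+1; split=> /=.
  apply: adaptedD; first exact: adaptedS.
  by apply: adaptedM; [exact: adaptedS|exact: adapted_slotv].
apply: L2D => //; exact: (L2_indep mbp lam01).
Qed.

(** In the square of the recursion the cross term contains an independent centered factor and
    vanishes, while the last term factors by independence. *)
Lemma mean_sqr_elem_sym t n : mean (fun w => elem_sym t n w ^+ 2) =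
  elem_sym_cst (slot_mean (fun x => G x ^+ 2)) t n.
Proof.
elim: t n => [|t IH] [|n] /=.
- by rewrite -[RHS](mean_cst P 1); congr mean; apply/funext => w; rewrite expr1n.
- by rewrite -[RHS](mean_cst P 0); congr mean; apply/funext => w; rewrite expr0n.
- by rewrite -[RHS](mean_cst P 1); congr mean; apply/funext => w; rewrite expr1n.
have [an n2] := elem_sym_adapted t n; have [aS S2] := elem_sym_adapted t n.+1.
have G21 : L1 (fun w => G (slotv 1 w) ^+ 2) by have [] := G2.
transitivity (mean (fun w => (elem_sym t n.+1 w ^+ 2 +
  2 * (elem_sym t n.+1 w * elem_sym t n w * G (slotv t.+1 w))) +
  elem_sym t n w ^+ 2 * (G (slotv t.+1 w)) ^+ 2)).
  by congr mean; apply/funext => w; ring.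
have m1 : L1 (fun w => elem_sym t n.+1 w * elem_sym t n w * G (slotv t.+1 w)).
  by apply: (L1_indep mbp lam01 (adaptedM aS an)); [exact: L2M|exact: L2_L1].
have m2 : L1 (fun w => elem_sym t n w ^+ 2 * (G (slotv t.+1 w)) ^+ 2).
  apply: (@L1_indep _ _ _ _ _ _ _ _ _ mbp lam01 t _ (fun x => G x ^+ 2)) => //.
    exact: (adaptedM an an).
  by have [] := n2.
have s1 : L1 (fun w => elem_sym t n.+1 w ^+ 2) by have [] := S2.
rewrite meanD//; last by apply: L1D => //; exact: L1Z.
rewrite meanD ?meanZ//; last exact: L1Z.
rewrite (mean_indep mbp lam01 (adaptedM aS an)); [|exact: L2M|exact: L2_L1].
rewrite (_ : mean (fun w => G (slotv 1 w)) = 0)// mulr0 mulr0 addr0 IH; congr (_ + _).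
rewrite (@mean_indep _ _ _ _ _ _ _ _ _ mbp lam01 t _ (fun x => G x ^+ 2)) ?IH//.
- exact: (adaptedM an an).
- by have [] := n2.
Qed.

Variables (T : nat) (h : nat -> int -> R).
Hypothesis h_proj : forall t j, (0 < t <= T)%N -> I j -> h t (e j) = proj_coef G j.

(** Without a point at [t.+1], the summand of [elem_sym] involving that slot has mean zero. With
    one, only that summand survives; its new factor is [h] times the pairing [proj_coef * incr_var],
    that is [h^2 * incr_var]. *)
Lemma mean_elem_sym_chaos_term t s : (t <= T)%N -> chronological t s ->
  mean (fun w => elem_sym t (size s) w * chaos_term h s w) = chaos_var h s.
Proof.
have nil_case r : mean (fun w => elem_sym r 0 w * chaos_term h [::] w) = chaos_var h [::].
  rewrite /chaos_var big_nil -[RHS](mean_cst P 1); congr mean.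
  by apply/funext => w; rewrite /chaos_term big_nil mulr1; case: r.
elim: t s => [|t IH] s tT; first by move=> /chronological0 ->; exact: nil_case.
have h0 : (0 < t.+1 <= T)%N by [].
case/chronologicalS => [|[s1 [j [-> cs Ij]]]].
  case: s => [_|p s cs]; first exact: nil_case.
  have [an n2] := elem_sym_adapted t (size s); have [aS S2] := elem_sym_adapted t (size s).+1.
  have [as_ s2] := chaos_term_adapted h cs.
  rewrite (_ : (fun w => _) = fun w => elem_sym t (size s).+1 w * chaos_term h (p :: s) w +
    elem_sym t (size s) w * chaos_term h (p :: s) w * G (slotv t.+1 w)); last first.
    by apply/funext => w /=; ring.
  have A := adaptedM an as_.
  rewrite meanD.
  - rewrite (IH (p :: s) (ltnW tT) cs).
    rewrite (mean_indep mbp lam01 A); [|exact: L2M|exact: L2_L1].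
    by rewrite (_ : mean (fun w => G (slotv 1 w)) = 0)// mulr0 addr0.
  - exact: L2M.
  - by apply: (L1_indep mbp lam01 A); [exact: L2M|exact: L2_L1].
have [an n2] := elem_sym_adapted t (size s1); have [aS S2] := elem_sym_adapted t (size s1).+1.
have [as_ s2] := chaos_term_adapted h cs.
pose phi x := h t.+1 (e j) * incr j x.
pose psi x := h t.+1 (e j) * (G x * incr j x).
have phi1 : L1 (fun w => phi (slotv 1 w)) by exact/L2_L1/L2Z/L2_incr.
have psi1 : L1 (fun w => psi (slotv 1 w)) by apply/L1Z/L2M => //; exact: L2_incr.
rewrite size_rcons (_ : (fun w => _) = fun w =>
    elem_sym t (size s1).+1 w * chaos_term h s1 w * phi (slotv t.+1 w) +
    elem_sym t (size s1) w * chaos_term h s1 w * psi (slotv t.+1 w)); last first.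
  by apply/funext => w; rewrite chaos_term_rcons /phi /psi/=; ring.
have A := adaptedM an as_; have B := adaptedM aS as_.
rewrite meanD; [|by apply: (L1_indep mbp lam01 B) => //; exact: L2M
                |by apply: (L1_indep mbp lam01 A) => //; exact: L2M].
rewrite (mean_indep mbp lam01 B) => //; last exact: L2M.
rewrite (mean_indep mbp lam01 A) => //; last exact: L2M.
have -> : mean (fun w => phi (slotv 1 w)) = 0.
  rewrite meanZ; last exact/L2_L1/L2_incr.
  by have := slot_mean_incr j; rewrite /slot_mean => ->; rewrite mulr0.
have -> : mean (fun w => psi (slotv 1 w)) = h t.+1 (e j) ^+ 2 * incr_var j.
  rewrite meanZ; last by apply: L2M => //; exact: L2_incr.
  have := slot_mean_proj G2 j; rewrite /slot_mean => ->.
  by rewrite -(h_proj h0 Ij) expr2 mulrA.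
by rewrite mulr0 add0r (IH _ (ltnW tT) cs) chaos_var_rcons.
Qed.

(** The finite truncations used as thresholds: times up to [t] and mark indices below [N]. *)
Fixpoint chron_tuples (N t n : nat) {struct t} : seq (n.-tuple (nat * nat)) :=
  match n with
  | 0 => [:: [tuple]]
  | n'.+1 => if t is t'.+1 then
      chron_tuples N t' n'.+1 ++
      [seq rcons_tuple s (t'.+1, j) | s : n'.-tuple (nat * nat) <- chron_tuples N t' n',
         j : nat <- [seq j <- iota 0 N | `[< I j >]]]
    else [::]
  end.

Lemma chron_tuplesP N t n s : s \in chron_tuples N t n -> chronological t s.
Proof.
elim: t n s => [|t IH] [|n] s /=.
- by rewrite inE => /eqP ->; exact: chronological_nil.
- by [].
- by rewrite inE => /eqP ->; exact: chronological_nil.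
rewrite mem_cat => /orP[/IH|]; first exact: chronological_le.
move=> /allpairsP[[s1 j] /= [/IH cs]].
rewrite mem_filter => /andP[/asboolP Ij _] ->.
exact: chronological_rcons.
Qed.

Lemma uniq_chron_tuples N t n : uniq (chron_tuples N t n).
Proof.
elim: t n => [|t IH] [|n] //=; rewrite cat_uniq IH /=; apply/andP; split.
  apply/hasPn => s /allpairsP[[s1 j] /= [_ _ ->]]; apply/negP => /chron_tuplesP.
  case=> _ /(_ (t.+1, j)); rewrite /= mem_rcons mem_head => /(_ isT)[].
  by rewrite /= ltnn.
apply: allpairs_uniq; [exact: IH|by rewrite filter_uniq// iota_uniq|].
move=> [s1 j1] [s2 j2] _ _ /= /(congr1 val)/= /rcons_inj[s12 ->].
by congr (_, _); exact: val_inj.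
Qed.

(** The coefficients of [h] do not depend on time up to [T], so each time contributes the same
    Bessel sum. Indices outside [I] add nothing, their variance being 0. *)
Lemma sum_chron_tuples N t n : (t <= T)%N ->
  \sum_(s <- chron_tuples N t n) chaos_var h s =
  elem_sym_cst (\sum_(j < N) proj_coef G j ^+ 2 * incr_var j) t n.
Proof.
elim: t n => [|t IH] [|n] tT /=; rewrite ?big_seq1 ?big_nil//.
- by rewrite /chaos_var big_nil.
- by rewrite /chaos_var big_nil.
rewrite big_cat/= IH ?(ltnW tT)//; congr (_ + _).
rewrite big_allpairs_dep -IH ?(ltnW tT)// mulr_suml; apply: eq_bigr => s _.
under eq_bigr => j _ do rewrite chaos_var_rcons/=.
rewrite -mulr_sumr; congr (_ * _).
rewrite big_filter (_ : iota 0 N = index_iota 0 N) ?big_mkord; last first.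
  by rewrite /index_iota subn0.
rewrite big_mkcond/=; apply: eq_bigr => j _.
case: ifPn => [/asboolP Ij|/negbTE nIj]; first by rewrite h_proj.
by rewrite /incr_var /mark_prob nIj !mul0r mulr0.
Qed.

Lemma elem_sym_cst_cvg (c : nat -> R) l t n : c @ \oo --> l ->
  (fun N => elem_sym_cst (c N) t n) @ \oo --> elem_sym_cst l t n.
Proof.
move=> cl; elim: t n => [|t IH] [|n] /=; try exact: cvg_cst.
by apply: cvgD => //; exact: cvgM.
Qed.

(** Both sides are [elem_sym_cst], at the second moment of [G] and at its partial Bessel sums;
    continuity reduces the claim to [parseval_slot]. *)
Lemma parseval_elem_sym t n eps : (t <= T)%N -> 0 < eps -> exists N,
  mean (fun w => elem_sym t n w ^+ 2) <
  \sum_(s <- chron_tuples N t n) chaos_var h s + eps.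
Proof.
move=> tT eps0; rewrite mean_sqr_elem_sym.
pose c N := \sum_(j < N) proj_coef G j ^+ 2 * incr_var j.
have cl : c @ \oo --> slot_mean (fun x => G x ^+ 2).
  have c_le N : c N <= slot_mean (fun x => G x ^+ 2).
    exact: bessel_slot.
  apply/cvgrPdist_lt => eps' eps'0; have [N cN] := parseval_slot G2 G0 eps'0.
  exists N => // m /= Nm; rewrite ger0_norm ?subr_ge0// ltrBlDr.
  rewrite addrC; apply: lt_le_trans cN _; rewrite lerD2r.
  rewrite -(subnKC Nm) /c big_split_ord/= lerDl; apply: sumr_ge0 => j _.
  by rewrite mulr_ge0 ?sqr_ge0// incr_var_ge0.
have := @elem_sym_cst_cvg c _ t n cl => /cvgrPdist_lt /(_ _ eps0)[N _ /(_ N (leqnn N))].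
move=> /= lN; exists N; rewrite sum_chron_tuples// -/(c N).
by rewrite -ltrBlDl; apply: le_lt_trans (ler_norm _) lN.
Qed.

End elementary_symmetric.

Lemma L2_chaos_term (h : nat -> int -> R) n (s : n.-tuple (nat * nat)) :
  increasing I s -> L2 (chaos_term h s).
Proof. by move=> /increasing_chronological[t /(chaos_term_adapted h)[]]. Qed.

Lemma chaos_term_orth (h : nat -> int -> R) n (s s' : n.-tuple (nat * nat)) :
  increasing I s -> increasing I s' -> s <> s' ->
  mean (fun w => chaos_term h s w * chaos_term h s' w) = 0.
Proof.
move=> /increasing_chronological[t cs] /increasing_chronological[t' cs'] ss'.
rewrite (@mean_chaos_termM h (maxn t t')).
- by case: eqP => // /val_inj.
- exact: chronological_le (leq_maxl _ _) cs.
- exact: chronological_le (leq_maxr _ _) cs'.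
Qed.

(** * Multiple integrals as elementary symmetric functions *)

Section chaos_sums.
Variable G : option int -> R.
Hypothesis G2 : L2 (fun w => G (slotv 1 w)).
Hypothesis G0 : slot_mean G = 0.
Variables (T : nat) (h : nat -> int -> R).
Hypothesis h_proj : forall t j, (0 < t <= T)%N -> I j -> h t (e j) = proj_coef G j.
Hypothesis h_zero : forall t k, (T < t)%N -> h t k = 0.

Let late_term (s : seq (nat * nat)) t : chronological t s ->
  chronological T s \/ (forall w, chaos_term h s w = 0).
Proof.
move=> [ps sP].
have [/allP sT|/allPn[p ps' pT]] := boolP (all (fun p => p.1 <= T)%N s).
  by left; split=> // p ps'; have [/andP[p0 _] Ip] := sP p ps'; rewrite p0 sT.
right=> w; apply/eqP; rewrite /chaos_term prodf_seq_eq0; apply/hasP; exists p => //.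
by rewrite h_zero ?mul0r ?eqxx// ltnNge.
Qed.

Lemma mean_elem_sym_term n (s : n.-tuple (nat * nat)) : increasing I s ->
  mean (fun w => elem_sym G T n w * chaos_term h s w) =
  mean (fun w => chaos_term h s w ^+ 2).
Proof.
move=> /increasing_chronological[t cs].
have [cT|s0] := late_term cs.
  rewrite (chaos_term_sqr h cT) -(mean_elem_sym_chaos_term G2 G0 h_proj (leqnn T) cT).
  by rewrite size_tuple.
by congr mean; apply/funext => w; rewrite s0 expr0n mulr0.
Qed.

Lemma chaos_is_L2sum n : is_L2sum P (@increasing I n)
  (fun s => chaos_term h s) (elem_sym G T n).
Proof.
apply: parseval_is_L2sum.
- exact: L2_chaos_term.
- exact: chaos_term_orth.
- by have [] := elem_sym_adapted G2 T n.
- exact: mean_elem_sym_term.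
move=> eps eps0; have [N lN] := parseval_elem_sym G2 G0 h_proj n (leqnn T) eps0.
exists [fset s in chron_tuples N T n]%fset.
  by move=> s /=; rewrite !inE => /chron_tuplesP; exact: chronological_increasing.
rewrite (_ : \sum_(s <- _) _ = \sum_(s <- chron_tuples N T n) chaos_var h s)//.
rewrite (perm_big (chron_tuples N T n)); last first.
  apply: uniq_perm; [exact: fset_uniq|exact: uniq_chron_tuples|].
  by move=> s; rewrite !inE.
by apply: eq_big_seq => s /chron_tuplesP; exact: chaos_term_sqr.
Qed.

End chaos_sums.

(** The closed form of [dR] is valid only for indices in [I], which suffices because the tuples
    summed over have theirs in [I]. *)
Lemma JE (h : nat -> int -> R) n : J P lam Q gap V I e (@tens R h n) =
  fun w => n`!%:R * L2sum P (@increasing I n) (fun s => chaos_term h s) w.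
Proof.
apply/funext => w; rewrite /J; congr (_ * _); congr (_ w); apply: eq_L2sum => s [_ sP].
apply/funext => w'; rewrite /tens /chaos_term big_map big_split/=; congr (_ * _).
by apply: eq_big_seq => p /sP[_ Ip]; rewrite dRE.
Qed.

(** * The exponential as a product over slots *)

Section doleans_exponential.
Variable G : option int -> R.
Hypothesis G2 : L2 (fun w => G (slotv 1 w)).
Hypothesis G0 : slot_mean G = 0.
Variables (T : nat) (h : nat -> int -> R).
Hypothesis h_proj : forall t j, (0 < t <= T)%N -> I j -> h t (e j) = proj_coef G j.
Hypothesis h_zero : forall t k, (T < t)%N -> h t k = 0.

Lemma J_elem_sym n :
  {ae P, forall w, J P lam Q gap V I e (@tens R h n) w = n`!%:R * elem_sym G T n w}.
Proof.
have X := chaos_is_L2sum G2 G0 h_proj h_zero n.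
have := is_L2sum_unique (@L2_chaos_term h n) (is_L2sum_L2sum X) X.
by apply: filterS => w; rewrite JE => ->.
Qed.

Lemma L2_J n : L2 (J P lam Q gap V I e (@tens R h n)).
Proof.
rewrite JE; apply: L2Z; apply: (is_L2sum_L2 (@L2_chaos_term h n)).
exact: (is_L2sum_L2sum (chaos_is_L2sum G2 G0 h_proj h_zero n)).
Qed.

(** [elem_sym T n] vanishes for [n > T], so any index set containing [1, ..., T] has error 0 almost
    surely. The exceptional sets of the countably many [J] are merged first. *)
Lemma doleans_prod : {ae P, forall w, doleans P lam Q gap V I e h w =
  \prod_(s < T) (1 + G (slotv s.+1 w))}.
Proof.
pose v n w := n`!%:R^-1 * J P lam Q gap V I e (@tens R h n) w.
pose X w := \sum_(n < T) elem_sym G T n.+1 w.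
have v2 n : L2 (v n) by apply: L2Z; exact: L2_J.
have vE : {ae P, forall w n, v n w = elem_sym G T n w}.
  apply: ae_foralln => n; apply: filterS (J_elem_sym n) => w; rewrite /v => ->.
  by rewrite mulKf// pnatr_eq0 -lt0n fact_gt0.
have X2 : L2 X by apply: L2_sum => n _; have [] := elem_sym_adapted G2 T n.+1.
have vX : is_L2sum P [set n | (0 < n)%N] v X.
  apply/is_L2sumP => // eps eps0.
  exists [fset n in iota 1 T]%fset.
    by move=> n /=; rewrite !inE mem_iota => /andP[].
  move=> B AB BD; rewrite (_ : mean _ = 0)//.
  rewrite -[RHS](mean_cst P 0); apply: mean_ae.
  - have B2 : L2 (fun w => X w - \sum_(i <- B) v i w).
      by apply: L2B => //; exact: L2_sum.
    by apply: measurable_funX; case: B2.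
  - exact: measurable_cst.
  apply: filterS vE => w vw; under eq_bigr do rewrite vw.
  rewrite (sum_fsetD _ AB) [X in _ - (_ + X)]big1_seq ?addr0; last first.
    move=> n /=; rewrite !inE mem_iota add1n ltnS => /andP[nA nB].
    rewrite elem_sym_gt// ltnNge; apply: contra nA => ->.
    by rewrite andbT; exact: (BD n nB).
  rewrite (perm_big (iota 1 T)); last first.
    apply: uniq_perm; [exact: fset_uniq|exact: iota_uniq|].
    by move=> n; rewrite !inE.
  rewrite (_ : iota 1 T = [seq n.+1 | n <- index_iota 0 T]); last first.
    by rewrite /index_iota subn0 (iotaDl 1 0 T).
  by rewrite big_map big_mkord subrr expr0n.
have := is_L2sum_unique (fun n _ => v2 n) (is_L2sum_L2sum vX) vX.
apply: filterS => w; rewrite /doleans -/v => ->.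
rewrite -sum_elem_sym [RHS]big_ord_recl; congr (_ + _).
by case: (T).
Qed.

End doleans_exponential.

(** * The kernel [h]: existence, integrability, uniqueness *)

Section kernel_existence.
Variable G : option int -> R.
Hypothesis G2 : L2 (fun w => G (slotv 1 w)).
Hypothesis G0 : slot_mean G = 0.
Variable T : nat.

Definition mark_rank (k : int) : nat := xget 0%N [set n | I n /\ e n = k].

Lemma mark_rankK j : I j -> mark_rank (e j) = j.
Proof.
move=> Ij; have [Ir er] : [set n | I n /\ e n = e j] (mark_rank (e j)).
  by apply: (xgetPex 0%N); exists j.
exact: e_inj.
Qed.

Definition proj_kernel t k : R :=
  if (0 < t <= T)%N then proj_coef G (mark_rank k) else 0.

Lemma proj_kernelE t j : (0 < t <= T)%N -> I j ->
  proj_kernel t (e j) = proj_coef G j.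
Proof. by move=> tT Ij; rewrite /proj_kernel tT mark_rankK. Qed.

Lemma proj_kernel_late t k : (T < t)%N -> proj_kernel t k = 0.
Proof. by rewrite /proj_kernel [(t <= T)%N]leqNgt => ->; rewrite andbF. Qed.

End kernel_existence.

Lemma tuple1_thead (A : Type) (s : 1.-tuple A) : s = [tuple thead s].
Proof.
by case/tupleP: s => x s; apply: val_inj; rewrite /= theadE (tuple0 s).
Qed.

(** Bridges the two index sets: [J] in degree 1 sums over 1-tuples of indices, [inL2] over points of
    the space. *)
Definition point_of (s : 1.-tuple (nat * nat)) : nat * int :=
  ((thead s).1, e (thead s).2).

Lemma point_of_bij : set_bij (@increasing I 1) (Defs.space E) point_of.
Proof.
case: enumE => _ [eE einj esurj]; split.
- move=> s [_ sP]; have [s0 Is] := sP _ (mem_tnth ord0 s).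
  by split=> //=; exact: eE.
- move=> s s'; rewrite !inE => -[_ sP] [_ s'P] [h1 h2].
  have [_ Is] := sP _ (mem_tnth ord0 s); have [_ Is'] := s'P _ (mem_tnth ord0 s').
  rewrite (tuple1_thead s) (tuple1_thead s'); congr [tuple _].
  rewrite [thead s]surjective_pairing [thead s']surjective_pairing h1.
  by congr (_, _); exact: e_inj.
move=> [t k] [/= t0 Ek]; have [j Ij jk] := esurj _ Ek.
exists [tuple (t, j)]; last by rewrite /point_of /thead /= jk.
by split=> // p; rewrite inE => /eqP ->.
Qed.

Lemma esum_space (f : nat * int -> \bar R) :
  (\esum_(x in Defs.space E) f x = \esum_(s in @increasing I 1) f (point_of s))%E.
Proof. exact: reindex_esum point_of_bij. Qed.

Lemma intensity_point (s : 1.-tuple (nat * nat)) : increasing I s ->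
  intensity lam Q (point_of s).1 (point_of s).2 = mark_prob (thead s).2.
Proof.
move=> [_ sP]; have [_ Is] := sP _ (mem_tnth ord0 s).
by rewrite /mark_prob asboolT.
Qed.

Lemma chaos_var1 h (s : 1.-tuple (nat * nat)) : chaos_var h s =
  h (point_of s).1 (point_of s).2 ^+ 2 * incr_var (thead s).2.
Proof. by rewrite [in LHS](tuple1_thead s) /chaos_var big_seq1. Qed.

(** Bessel in degree 1 bounds the sum of [h^2 * incr_var] by the norm of [elem_sym G T 1]; passing
    from variances to intensities costs the factor [1 / (1 - lam)], by [incr_var_ge]. *)
Lemma inL2_proj_kernel G T : L2 (fun w => G (slotv 1 w)) -> slot_mean G = 0 ->
  inL2 lam Q E (proj_kernel G T).
Proof.
move=> G2 G0; set h := proj_kernel G T.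
have h_proj := @proj_kernelE G T; have h_zero := @proj_kernel_late G T.
pose C := mean (fun w => elem_sym G T 1 w ^+ 2) / (1 - lam).
have lam0 : 0 < 1 - lam by have /andP[] := lam01; lra.
rewrite /inL2 esum_space; apply: (@le_lt_trans _ _ C%:E); last exact: ltry.
apply: ub_ereal_sup => _ [X [finX XD] <-].
rewrite fsbig_finite//= sumEFin lee_fin /C ler_pdivlMr//.
have [an n2] := elem_sym_adapted G2 T 1.
have XD' : [set` fset_set X] `<=` @increasing I 1.
  by move=> s; rewrite /= in_fset_set// inE => /XD.
have := bessel (@L2_chaos_term h 1) (@chaos_term_orth h 1) n2 XD'
  (mean_elem_sym_term G2 G0 h_proj h_zero (n := 1)).
apply: le_trans; rewrite mulr_suml; rewrite big_seq [X in _ <= X]big_seq.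
apply: ler_sum => s sX.
have sI : increasing I s by exact: XD'.
have [t cs] := increasing_chronological sI.
rewrite (chaos_term_sqr h cs) chaos_var1 -/h intensity_point// -mulrA.
apply: ler_wpM2l; first exact: sqr_ge0.
by rewrite mulrC incr_var_ge.
Qed.

(** For an arbitrary [h] no candidate limit is at hand, so the limit comes from completeness;
    [incr_var_le] bounds the energies by the norm of [h]. *)
Lemma chaos1_is_L2sum h : inL2 lam Q E h ->
  is_L2sum P (@increasing I 1) (fun s => chaos_term h s)
    (L2sum P (@increasing I 1) (fun s => chaos_term h s)).
Proof.
move=> h2.
pose S := (\esum_(x in Defs.space E) ((h x.1 x.2) ^+ 2 * intensity lam Q x.1 x.2)%:E)%E.
have [|X] := @summable_is_L2sum _ _ _ P _ _ _ (@L2_chaos_term h 1)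
  (@chaos_term_orth h 1) (fine S).
  move=> B BD; rewrite -lee_fin fineK; last first.
    rewrite ge0_fin_numE//; apply: esum_ge0 => x _; rewrite lee_fin.
    rewrite mulr_ge0 ?sqr_ge0//; exact: (slot_law_ge0 Q lam01 (Some x.2)).
  rewrite /S esum_space; apply: esum_ge; exists [set` B].
    by split.
  rewrite -fsbig_seq ?fset_uniq// sumEFin lee_fin; rewrite big_seq [X in _ <= X]big_seq.
  apply: ler_sum => s sB.
  have sI : increasing I s by exact: BD.
  have [t cs] := increasing_chronological sI.
  rewrite (chaos_term_sqr h cs) chaos_var1 intensity_point//.
  by apply: ler_wpM2l; [exact: sqr_ge0|exact: incr_var_le].
exact: is_L2sum_L2sum.
Qed.

Lemma J1_inj h h' : inL2 lam Q E h -> inL2 lam Q E h' ->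
  {ae P, forall w, J P lam Q gap V I e (@tens R h 1) w =
                   J P lam Q gap V I e (@tens R h' 1) w} ->
  forall t k, (0 < t)%N -> E k -> h t k = h' t k.
Proof.
move=> h2 h2' JJ t k t0 Ek.
have [j Ij jk] : (e @` I) k by case: enumE => _ [_ _]; apply.
rewrite -{}jk {Ek k}; pose s0 : 1.-tuple (nat * nat) := [tuple (t, j)].
have cs0 : chronological t s0.
  by split=> // p; rewrite inE => /eqP -> /=; rewrite t0 leqnn.
have s0I := chronological_increasing cs0.
pose v w := incr j (slotv t w).
have v2 : L2 v by rewrite /v -(prednK t0); exact: L2_incr.
have termE f (s : 1.-tuple (nat * nat)) w : chaos_term f s w =
    f (point_of s).1 (point_of s).2 * incr (thead s).2 (slotv (thead s).1 w).
  by rewrite [in LHS](tuple1_thead s) /chaos_term big_seq1.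
(* With the constant kernel 1, the test increment is itself a chaos term, so orthogonality of chaos
   terms applies to it. *)
pose one (_ : nat) (_ : int) : R := 1.
have vE w : v w = chaos_term one s0 w by rewrite termE mul1r.
have coef f : inL2 lam Q E f -> mean (fun w =>
    L2sum P (@increasing I 1) (fun s => chaos_term f s) w * v w) =
    f t (e j) * incr_var j.
  move=> f2; rewrite (is_L2sum_coef (@L2_chaos_term f 1) (chaos1_is_L2sum f2) v2 s0I).
    rewrite (_ : (fun w => _) = fun w => f t (e j) * (incr j (slotv t w) ^+ 2)).
      rewrite meanZ; last by case: v2.
      congr (_ * _); rewrite -slot_mean_sqr_incr -(prednK t0).
      apply: (@mean_slotv _ _ _ _ _ _ _ _ _ mbp lam01 _ (fun x => incr j x ^+ 2)).
      by case: (L2_incr j 0).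
    by apply/funext => w; rewrite termE /v /= expr2 mulrA.
  move=> s sI ss0; have [t' cs] := increasing_chronological sI.
  rewrite (_ : (fun w => _) = fun w => f (point_of s).1 (point_of s).2 *
      (chaos_term one s w * chaos_term one s0 w)); last first.
    by apply/funext => w; rewrite !termE vE termE !mul1r mulrA.
  rewrite meanZ; last by apply: L2M; exact: L2_chaos_term.
  rewrite (@mean_chaos_termM one (maxn t' t)).
  + by case: eqP => [/val_inj//|_]; rewrite mulr0.
  + exact: chronological_le (leq_maxl _ _) cs.
  + exact: chronological_le (leq_maxr _ _) cs0.
(* Positivity of [Q] on [E] makes the variance invertible, so the pairing determines the kernel at
   the point. *)
have var0 : incr_var j != 0 by rewrite gt_eqF// incr_var_gt0.
apply: (mulIf var0); rewrite -(coef h h2) -(coef h' h2').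
apply: mean_ae.
- apply: measurable_funM; last by case: v2.
  by have [] := is_L2sum_L2 (@L2_chaos_term h 1) (chaos1_is_L2sum h2).
- apply: measurable_funM; last by case: v2.
  by have [] := is_L2sum_L2 (@L2_chaos_term h' 1) (chaos1_is_L2sum h2').
apply: filterS JJ => w; rewrite !JE /= => hw.
by congr (_ * _); move: hw; rewrite /= !mul1r.
Qed.

Lemma sqr_sum_le (T : nat) (a : nat -> R) :
  (\sum_(s < T) a s) ^+ 2 <= T%:R * \sum_(s < T) a s ^+ 2.
Proof.
elim: T => [|T IH]; first by rewrite !big_ord0 expr0n mul0r.
rewrite !big_ord_recr/=; set S := \sum_(i < T) a i in IH *.
set S2 := \sum_(i < T) a i ^+ 2 in IH *.
have : 2 * S * a T <= S2 + T%:R * a T ^+ 2.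
  rewrite (_ : T%:R * _ = \sum_(s < T) a T ^+ 2); last first.
    by rewrite sumr_const card_ord mulr_natl.
  rewrite /S /S2 -big_split/= mulr_sumr mulr_suml; apply: ler_sum => s _.
  by have := sqr_ge0 (a s - a T); nra.
by rewrite -natr1; nra.
Qed.

(** * The integral of a kernel against [dZ] *)

Section integral_Z.
Variable g : option int -> R.
Hypothesis g2 : L2 (fun w => g (slotv 1 w)).
Hypothesis g_None : g None = 0.
Variable T : nat.

(** The part of [g] at time [s] captured by the finite set [B]; a slot has one mark, so at most one
    summand is nonzero. *)
Let hit (B : {fset nat * int}) (s : nat) (x : option int) : R :=
  \sum_(y <- B | y.1 == s) g (Some y.2) * (x == Some y.2)%:R.

Let hitE B s x : hit B s x =
  if x is Some k then if (s, k) \in B then g x else 0 else 0.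
Proof.
rewrite /hit; case: x => [k|]; last by rewrite big1// => y _; rewrite mulr0.
case: ifPn => skB.
  rewrite big_mkcond (big_fsetD1 _ skB)/= !eqxx mulr1 big_seq big1 ?addr0//.
  move=> [s' k']; rewrite !inE/= => /andP[sk _]; case: eqP => // ss.
  case: eqP => [[kk]|_]; last by rewrite mulr0.
  by move: sk; rewrite ss kk eqxx.
rewrite big_seq_cond big1// => -[s' k'] /= /andP[yB /eqP ss].
case: eqP => [[kk]|_]; last by rewrite mulr0.
by move: skB; rewrite kk -ss yB.
Qed.

Let L2_hit B s t : L2 (fun w => hit B s (slotv t.+1 w)).
Proof.
rewrite /hit (_ : (fun w => _) = fun w => \sum_(y <- B)
    (if y.1 == s then g (Some y.2) else 0) * (slotv t.+1 w == Some y.2)%:R).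
  apply: L2_sum => y _; apply: L2Z.
  apply: (@L2_slot_bounded 1 (fun x => (x == Some y.2)%:R)) => x.
  by rewrite ger0_norm// lern1 leq_b1.
apply/funext => w; rewrite big_mkcond; apply: eq_bigr => y _.
by case: ifP; rewrite ?mul0r.
Qed.

Let mean_hit B s : slot_mean (hit B s) =
  \sum_(y <- B | y.1 == s) g (Some y.2) * slot_law lam Q (Some y.2).
Proof.
have L1eq y : L1 (fun w => (slotv 1 w == Some y)%:R).
  apply/L2_L1/(@L2_slot_bounded 1 (fun x => (x == Some y)%:R)) => x.
  by rewrite ger0_norm// lern1 leq_b1.
rewrite /slot_mean /hit big_mkcond/= (_ : (fun w => _) = fun w => \sum_(y <- B)
    (if y.1 == s then g (Some y.2) else 0) * (slotv 1 w == Some y.2)%:R).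
  rewrite mean_sum => [|y _]; last exact: L1Z.
  apply: eq_bigr => y _; rewrite meanZ// (mean_slotv_eq mbp).
  by case: ifP; rewrite ?mul0r.
apply/funext => w; rewrite big_mkcond; apply: eq_bigr => y _.
by case: ifP; rewrite ?mul0r.
Qed.

Let term (x : nat * int) (w : Omega) : R :=
  (if (x.1 <= T)%N then g (Some x.2) else 0) * dZ lam Q gap V x.1 x.2 w.

Let termE (B : {fset nat * int}) w : [set` B] `<=` Defs.space E -> \sum_(y <- B) term y w =
  \sum_(s < T) (hit B s.+1 (slotv s.+1 w) - slot_mean (hit B s.+1)).
Proof.
move=> BE; transitivity (\sum_(y <- B) \sum_(s < T) if y.1 == s.+1 then term y w else 0).
  rewrite big_seq [RHS]big_seq; apply: eq_bigr => -[t k] yB.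
  have [/= t0 _] := BE _ yB; rewrite -big_mkcond/=.
  have [tT|Tt] := leqP t T; last first.
    rewrite /term /= leqNgt Tt/= mul0r big1// => s.
  have tT' : (t.-1 < T)%N by rewrite prednK.
  rewrite (big_pred1 (Ordinal tT'))// => s /=.
  by rewrite -[in LHS](prednK t0) eqSS eq_sym.
rewrite exchange_big/=; apply: eq_bigr => s _.
rewrite -big_mkcond/= mean_hit /hit -sumrB; apply: eq_bigr => -[t k] /= /eqP ts.
rewrite /term /= ts ltn_ord -mulrBr; congr (_ * _); by rewrite /dZ indic_point.
Qed.

Lemma J1Z_term_L2 x : Defs.space E x -> L2 (term x).
Proof.
move=> [x0 _]; apply/L2Z/L2B; last exact: L2_cst.
rewrite indic_point -(prednK x0).
apply: (@L2_slot_bounded 1 (fun y => (y == Some x.2)%:R)) => y.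
by rewrite ger0_norm// lern1 leq_b1.
Qed.

(** The [dZ] at a given time are correlated, so the error is estimated directly: grouped by time, it
    is a sum of [T] centered variables, each with second moment at most that of [g] on the marks
    beyond the first [N]. *)
Lemma J1Z_is_L2sum : is_L2sum P (Defs.space E) term
  (fun w => \sum_(s < T) (g (slotv s.+1 w) - slot_mean g)).
Proof.
have g1 := L2_L1 g2.
have L2gs s : L2 (fun w => g (slotv s.+1 w)).
  have := L2_indep mbp lam01 (adapted_cst gap V s 1) (L2_cst P 1) g2.
  by rewrite (_ : (fun w => _) = (fun w => g (slotv s.+1 w)))//;
    apply/funext => w; rewrite mul1r.
have X2 : L2 (fun w => \sum_(s < T) (g (slotv s.+1 w) - slot_mean g)).
  by apply: L2_sum => s _; apply: L2B; [exact: L2gs|exact: L2_cst].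
apply/is_L2sumP => //; first exact: J1Z_term_L2.
move=> eps eps0.
(* One factor [T] is lost by Cauchy-Schwarz over the times and one by adding [T] errors of size [c];
   the 1 makes the inequality strict. *)
pose c := eps / (T%:R ^+ 2 + 1).
have T20 : 0 <= T%:R ^+ 2 :> R by exact: sqr_ge0.
have c0 : 0 < c by rewrite divr_gt0//; lra.
have [N gN] := rest_sqr_cvg0 g2 g_None c0.
exists [fset y in [seq (s.+1, e j) | s <- iota 0 T,
    j <- [seq j <- iota 0 N | `[< I j >]]]]%fset.
  move=> y; rewrite /= !inE => /allpairsP[[s j] /= [_]].
  rewrite mem_filter => /andP[/asboolP Ij _] ->; split=> //=.
  by case: enumE => _ [+ _ _]; exact.
move=> B AB BE.
pose phi s x := g x - hit B s.+1 x.
have phi2 s t : L2 (fun w => phi s (slotv t.+1 w)) by apply: L2B.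
(* [B] contains the first [N] marks at each time up to [T], so the mark of an uncaptured point lies
   beyond them, where [rest_ind N] is 1. *)
have phi_le (s : 'I_T) x : phi s x ^+ 2 <= g x ^+ 2 * rest_ind N x.
  rewrite /phi hitE; case: x => [k|]; last by rewrite g_None subrr expr0n mul0r.
  case: ifPn => [_|skB].
    by rewrite subrr expr0n/= mulr_ge0 ?sqr_ge0// rest_ind_ge0.
  rewrite subr0 ler_peMr ?sqr_ge0// /rest_ind big1 ?subr0// => j _.
  rewrite /mark_ind; case: ifPn => // Ij; case: eqP => // -[kj].
  case/negP: skB; apply: (fsubsetP AB); rewrite !inE kj; apply/allpairsP.
  exists (nat_of_ord s, nat_of_ord j); split=> //=.
    by rewrite mem_iota add0n ltn_ord.
  by rewrite mem_filter Ij mem_iota add0n ltn_ord.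
pose b s w := phi s (slotv s.+1 w) - slot_mean (phi s).
have b2 s : L2 (b s) by apply: L2B; [exact: phi2|exact: L2_cst].
(* Centering does not increase the second moment. *)
have b_le (s : 'I_T) : mean (fun w => b s w ^+ 2) <= c.
  have ps1 : L1 (fun w => phi s (slotv s.+1 w) ^+ 2) by case: (phi2 s s).
  have pl1 : L1 (fun w => phi s (slotv s.+1 w)) by exact: L2_L1.
  have p1 : L1 (fun w => phi s (slotv 1 w)) by exact: L2_L1.
  have p21 : L1 (fun w => phi s (slotv 1 w) ^+ 2) by case: (phi2 s 0).
  rewrite (_ : (fun w => _) = fun w => (phi s (slotv s.+1 w) ^+ 2 -
    (2 * slot_mean (phi s)) * phi s (slotv s.+1 w)) + slot_mean (phi s) ^+ 2);
    last by apply/funext => w; rewrite /b; ring.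
  have q1 := L1Z (2 * slot_mean (phi s)) pl1.
  rewrite meanD; [|exact: L1B|exact: L1_cst].
  rewrite meanB// meanZ// mean_cst.
  rewrite (mean_slotv mbp lam01 s p1).
  rewrite (mean_slotv mbp lam01 s (phi := fun x => phi s x ^+ 2) p21).
  rewrite -/(slot_mean (phi s)).
  have : mean (fun w => phi s (slotv 1 w) ^+ 2) <= c.
    apply: le_trans (ltW gN); apply: mean_le => //; first exact: L1_sqr_rest.
  by have := sqr_ge0 (slot_mean (phi s)); nra.
have -> : (fun w => (\sum_(s < T) (g (slotv s.+1 w) - slot_mean g) -
    \sum_(y <- B) term y w) ^+ 2) = fun w => (\sum_(s < T) b s w) ^+ 2.
  apply/funext => w; rewrite termE// -sumrB; congr (_ ^+ 2).
  apply: eq_bigr => s _; rewrite /b /phi.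
  rewrite (_ : slot_mean (fun x => g x - hit B s.+1 x) =
    slot_mean g - slot_mean (hit B s.+1)); first by ring.
  by rewrite /slot_mean meanB//; exact/L2_L1/L2_hit.
apply: (@le_lt_trans _ _ (mean (fun w => T%:R * \sum_(s < T) b s w ^+ 2))).
  apply: mean_le.
  - by have [] : L2 (fun w => \sum_(s < T) b s w) by apply: L2_sum.
  - by apply/L1Z/L1_sum => s _; case: (b2 s).
  - by move=> w; exact: (sqr_sum_le T (b ^~ w)).
have b21 s : L1 (fun w => b s w ^+ 2) by case: (b2 s).
rewrite meanZ; last exact: L1_sum.
rewrite mean_sum; last by move=> s _; exact: b21.
apply: (@le_lt_trans _ _ (T%:R * (T%:R * c))).
  rewrite ler_wpM2l// [X in X * c](_ : T%:R = \sum_(s < T) (1 : R)).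
    by rewrite mulr_suml; apply: ler_sum => s _; rewrite mul1r; exact: b_le.
  by rewrite sumr_const card_ord.
rewrite mulrA -expr2 /c mulrCA gtr_pMr// ltr_pdivrMr; lra.
Qed.

End integral_Z.

Lemma elem_sym1E G t w : elem_sym G t 1 w = \sum_(s < t) G (slotv s.+1 w).
Proof.
elim: t => [|t IH]; first by rewrite big_ord0.
by rewrite big_ord_recr/= -IH; case: t {IH} => [|t]; rewrite /= mul1r.
Qed.

(** Only the slice at time 1 of the intensity sum is kept. It is the second moment of [phi] at one
    slot, because a point of mark [k] has probability [intensity lam Q 1 k] and [phi] is 0 on the
    empty slot. *)
Lemma inL2_slot (phi : option int -> R) T : (0 < T)%N -> phi None = 0 ->
  inL2 lam Q E (fun t k => if (t <= T)%N then phi (Some k) else 0) ->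
  L2 (fun w => phi (slotv 1 w)).
Proof.
move=> T0 phi0 phi2; have mphi := measurable_comp_slotv mbp 0 phi.
have m1 x : measurable (slotv 1 @^-1` [set x]) by exact: (measurable_slotv mbp).
split=> //; apply/integrableP; split.
  by apply/measurable_EFinP; exact: measurable_funX.
apply: le_lt_trans phi2.
rewrite (eq_integral (fun w => (fun x => (phi x ^+ 2)%:E) (slotv 1 w))); last first.
  by move=> w _; rewrite /= ger0_norm// sqr_ge0.
rewrite (@integral_countable _ _ _ P _ (slotv 1) m1 (fun x => (phi x ^+ 2)%:E)) => [|x];
  last by rewrite lee_fin sqr_ge0.
pose F x := ((phi x ^+ 2)%:E * P (slotv 1 @^-1` [set x]))%E.
rewrite (_ : esum _ _ = \esum_(x in Some @` E) F x)%E; last first.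
  rewrite [RHS]esum_mkcond; apply: eq_esum => -[k|] _; case: ifPn => // kE.
    rewrite (_ : _ @^-1` _ = set0) ?measure0 ?mule0//.
    apply/seteqP; split=> w //= /slotvP[i [_ /= Vk]].
    move: kE; rewrite notin_setE; apply; exists k => //.
    by rewrite -Vk; exact: (mark_in mbp).
  by rewrite phi0 expr0n mul0e.
rewrite esum_image; last by move=> x y _ _ [].
rewrite (_ : esum _ _ = \esum_(x in (pair 1%N) @` E)
  ((if (x.1 <= T)%N then phi (Some x.2) else 0) ^+ 2 * intensity lam Q x.1 x.2)%:E)%E.
  rewrite esum_mkcond [leRHS]esum_mkcond; apply: le_esum => -[t k] _ /=.
  case: ifPn => [/set_mem[j Ej [<- <-]]|_]; first by rewrite mem_set//=.
  case: ifPn => // _; rewrite lee_fin mulr_ge0 ?sqr_ge0//.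
  exact: (slot_law_ge0 Q lam01 (Some k)).
rewrite esum_image; last by move=> x y _ _ [].
by apply: eq_esum => k _; rewrite /F /= T0 [X in (_ * X)%E](prob_slotv1 mbp) -EFinM.
Qed.

End chaos_expansion.

(** * Change of measure *)

(** The law of [f] given [D]: the pushforward of [Pt] restricted to [D], normalized. The long
    constant is the canonical measure structure of that pushforward, and [Q0] is the fallback of
    [mnormalize] for mass 0 or infinity. *)
Lemma conditional_law d (S : measurableType d) (R : realType)
    (Pt : probability S R) (Q0 : probability int R) (f : S -> int) (D : set S) :
  measurable_fun [set: S] f -> measurable D -> Pt D != 0%E ->
  exists Q : probability int R,
    forall B, Q B = (Pt (f @^-1` B `&` D) * (fine (Pt D))^-1%:E)%E.
Proof.
move=> mf mD PD.
pose m := measure_function_pushforward__canonical__measure_function_Measure (mrestr Pt mD) mf.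
exists (mnormalize m Q0) => B.
have mE A : m A = Pt (f @^-1` A `&` D) by [].
have mT : m setT = Pt D by rewrite mE preimage_setT setTI.
have PDy : (Pt D == +oo%E) = false.
  by apply/negbTE; rewrite -ltey ltey_eq fin_num_measure.
transitivity (mnormalize m Q0 B) => //.
by rewrite /mnormalize mT (negbTE PD) PDy /= mE.
Qed.

(** * Events of the filtration as sets of words *)

Section filtration.
Context {d : measure_display} {Omega : measurableType d} {R : realType}.
Variables (P : probability Omega R) (lam : R) (E : set int)
  (Q : probability int R).
Variables (gap : nat -> {RV P >-> nat}) (V : nat -> {RV P >-> int}).
Hypothesis mbp : marked_binomial lam E Q gap V.

Local Notation slotv := (slotv gap V).
Local Notation slots := (slots gap V).

(** Preimages under [slots t] form a sigma-algebra that contains the generators. *)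
Lemma history_slots t A : <<s history E gap V t >> A ->
  exists B, A = slots t @^-1` B.
Proof.
move=> /(_ [set A | exists B, A = slots t @^-1` B]); apply; split.
  split; first by exists set0; rewrite preimage_set0.
    move=> _ [B ->]; exists (~` B).
    by rewrite setTD preimage_setC.
  move=> F FB; have /choice[B BF] := FB.
  exists (\bigcup_n B n); rewrite preimage_bigcup.
  by apply: eq_bigcupr => n _; exact: BF.
move=> _ [s [k [/andP[s0 st] Ek ->]]].
exists [set o | nth None o s.-1 = Some k]; apply/seteqP.
have nthE w : nth None (slots t w) s.-1 = slotv s w.
  by rewrite nth_mkseq prednK.
split=> w /=; rewrite nthE.
  by move=> h; apply/(slotv_Some _ (gap_gt0 mbp)).
by move/(slotv_Some _ (gap_gt0 mbp)).
Qed.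

Variable T : nat.
Local Notation FT := (filt E gap V T).

(** Emptiness of a slot is not a generator: it is the complement of the countable union of the
    events [point t k]. Marks outside [E] are not generators either, but give empty events. *)
Lemma measurable_slotv_filt t x : (0 < t <= T)%N ->
  measurable (slotv t @^-1` [set x] : set FT).
Proof.
move=> tT.
have mS k : measurable (slotv t @^-1` [set Some k] : set FT).
  rewrite -(slotE V (gap_gt0 mbp) t (Some k)) /=.
  have [Ek|nEk] := pselect (E k).
    by apply: sub_sigma_algebra; exists t, k.
  rewrite (_ : Defs.point _ _ _ _ = set0); first exact: measurable0.
  apply/seteqP; split=> w //= [i [_ /= Vk]]; apply: nEk.
  by rewrite -Vk; exact: (mark_in mbp).
case: x => [k|]; first exact: mS.
rewrite (_ : _ @^-1` _ =
  ~` \bigcup_n (if choice.unpickle n is Some k then slotv t @^-1` [set Some k] else set0)).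
  apply: measurableC; apply: bigcup_measurable => n _.
  by case: choice.unpickle => [k|]; [exact: mS|exact: measurable0].
apply/seteqP; split=> w /=.
  by move=> w0 [n _]; case: choice.unpickle => //= k; rewrite w0.
case sw : (slotv t w) => [k|//] h; exfalso; apply: h.
by exists (choice.pickle k) => //; rewrite choice.pickleK.
Qed.

Lemma measurable_slots_filt t o : (t <= T)%N ->
  measurable (slots t @^-1` [set o] : set FT).
Proof.
elim: t o => [|t IH] o tT.
  case: o => [|x o]; last first.
    rewrite (_ : _ @^-1` _ = set0); first exact: measurable0.
    by apply/seteqP; split=> w //= h; have := size_slots gap V 0 w; rewrite h.
  rewrite (_ : _ @^-1` _ = setT); first exact: measurableT.
  by apply/seteqP; split=> w // _; exact: size0nil (size_slots _ _ _ _).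
case/lastP: o => [|o x].
  rewrite (_ : _ @^-1` _ = set0); first exact: measurable0.
  by apply/seteqP; split=> w //= h; have := size_slots gap V t.+1 w; rewrite h.
rewrite (_ : _ @^-1` _ = slots t @^-1` [set o] `&` slotv t.+1 @^-1` [set x]).
  by apply: measurableI; [exact: (IH o (ltnW tT))|exact: measurable_slotv_filt].
apply/seteqP; split=> w.
  by move=> h; move: (h : _ = _); rewrite slotsS => /rcons_inj[].
by move=> [h1 h2]; rewrite /preimage /mkset slotsS h1 h2.
Qed.

Lemma measurable_history t A : (t <= T)%N -> <<s history E gap V t >> A ->
  measurable (A : set FT).
Proof.
move=> tT /history_slots[B ->].
apply: (measurable_preimage_countable (Omega := FT)) => o.
exact: measurable_slots_filt.
Qed.

Lemma history_measurable t A : <<s history E gap V t >> A -> measurable A.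
Proof.
move=> /history_slots[B ->]; apply: measurable_preimage_countable => o.
exact: (measurable_slots mbp).
Qed.

End filtration.

(** * The slots under the new measure *)

Section change_of_law.
Context {d : measure_display} {Omega : measurableType d} {R : realType}.
Variables (P : probability Omega R) (lam : R) (E : set int)
  (Q : probability int R).
Variables (gap : nat -> {RV P >-> nat}) (V : nat -> {RV P >-> int}).
Hypothesis lam01 : 0 < lam < 1.
Hypothesis mbp : marked_binomial lam E Q gap V.
Variable T : nat.
Hypothesis T_gt0 : (0 < T)%N.
Variable Pt : probability (filt E gap V T) R.
Hypothesis equiv : equivalent_on P Pt.
Hypothesis mbpt : iid_slots Pt.

Local Notation slotv := (slotv gap V).
Local Notation slots := (slots gap V).

Definition tilted_law (x : option int) : R := fine (Pt (slotv 1 @^-1` [set x])).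

Let mslotv t x : (0 < t <= T)%N ->
  measurable (slotv t @^-1` [set x] : set (filt E gap V T)).
Proof. exact: (measurable_slotv_filt mbp). Qed.

Let mslots t o : (t <= T)%N ->
  measurable (slots t @^-1` [set o] : set (filt E gap V T)).
Proof. exact: (measurable_slots_filt mbp). Qed.

Let T1 : (0 < 1 <= T)%N. Proof. by []. Qed.

Let Pt_slotv1 x : Pt (slotv 1 @^-1` [set x]) = (tilted_law x)%:E.
Proof. by rewrite fineK//; apply: fin_num_measure; exact: mslotv. Qed.

Lemma tilted_slotv t x : (0 < t <= T)%N ->
  Pt (slotv t @^-1` [set x]) = (tilted_law x)%:E.
Proof.
move=> tT; rewrite -Pt_slotv1 -!(slotE V (gap_gt0 mbp)).
by case: mbpt => + _; apply.
Qed.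

Let tilted_slots_T o : size o = T ->
  Pt (slots T @^-1` [set o]) = (\prod_(x <- o) tilted_law x)%:E.
Proof.
move=> oT; rewrite -[LHS]fineK; last first.
  by apply: fin_num_measure; exact: mslots.
congr EFin; have := mbpt.2 (fun t => nth None o t.-1).
rewrite (_ : \bigcap_(t in _) _ = slots T @^-1` [set o]).
  move=> ->; rewrite (big_nth None) oT big_add1/= !big_mkord.
  apply: eq_bigr => i _; rewrite (slotE V (gap_gt0 mbp)) tilted_slotv//.
  by rewrite /= ltn_ord.
apply/seteqP; split=> [w h|w h t /andP[t0 tT]].
  apply: (@eq_from_nth _ None); rewrite size_slots// => i iT.
  rewrite nth_mkseq//; have /= := h i.+1; rewrite (slotE V (gap_gt0 mbp)).
  by apply.
rewrite (slotE V (gap_gt0 mbp)) -(h : _ = _) /=.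
by rewrite nth_mkseq prednK.
Qed.

(** [iid_slots] prescribes words of full length [T] only. Shorter ones follow by downward induction,
    summing out the last slot, whose law has total mass 1. *)
Let tilted_slots_size t o : (t <= T)%N -> size o = t ->
  Pt (slots t @^-1` [set o]) = (\prod_(x <- o) tilted_law x)%:E.
Proof.
move=> /subnK; move: (T - t)%N => n; elim: n t o => [|n IH] t o.
  by rewrite add0n => -> oT; exact: tilted_slots_T.
rewrite addSnnS => tT ot.
have tT' : (t < T)%N by rewrite -tT leq_addl.
rewrite (_ : slots t @^-1` [set o] = slots t.+1 @^-1` (rcons o @` setT)); last first.
  apply/seteqP; split=> [w h|w [x _ h]].
    by exists (slotv t.+1 w) => //; rewrite slotsS (h : _ = _).
  by move: h; rewrite slotsS => /rcons_inj[].
rewrite (measure_countable Pt (fun y => mslots y tT')) esum_image; last first.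
  by move=> x y _ _ /rcons_inj[].
have step x : Pt (slots t.+1 @^-1` [set rcons o x]) =
    ((\prod_(y <- o) tilted_law y)%:E * Pt (slotv 1 @^-1` [set x]))%E.
  by rewrite IH ?size_rcons ?ot// -cats1 big_cat big_seq1/= EFinM -Pt_slotv1.
rewrite (eq_esum (fun x _ => step x)).
rewrite -(@integral_countable _ _ _ Pt _ (slotv 1) (fun y => mslotv y T1)
  (fun=> (\prod_(x <- o) tilted_law x)%:E)) => [|y]; last first.
  by rewrite lee_fin; apply: prodr_ge0 => x _; exact: fine_ge0.
rewrite integral_cst// [X in (_ * X)%E](_ : _ = 1%E) ?mule1//.
exact: probability_setT.
Qed.

Lemma tilted_slots t o : (t <= T)%N -> Pt (slots t @^-1` [set o]) =
  (if size o == t then \prod_(x <- o) tilted_law x else 0)%:E.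
Proof.
move=> tT; case: eqVneq => [ot|ot]; first exact: tilted_slots_size.
rewrite (_ : _ @^-1` _ = set0) ?measure0//; apply/seteqP; split=> w //= h.
by move: ot; rewrite -h size_slots eqxx.
Qed.

(** [A] is a set of words of length [t], and appending [x] multiplies the probability of each by
    [tilted_law x]. For [x = Some k] this is the compensator identity. *)
Lemma tilted_slot t x A : (t < T)%N -> <<s history E gap V t >> A ->
  Pt (slotv t.+1 @^-1` [set x] `&` A) = ((tilted_law x)%:E * Pt A)%E.
Proof.
move=> tT /(history_slots mbp)[B ->].
have c0 : (0 <= (tilted_law x)%:E)%E by rewrite lee_fin fine_ge0.
have msl o : measurable (slots t @^-1` [set o] : set (filt E gap V T)).
  exact: mslots (ltnW tT).
rewrite (_ : _ `&` _ = slots t.+1 @^-1` ((rcons^~ x) @` B)); last first.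
  apply/seteqP; split=> [w [h Bw]|w [y By h]].
    by exists (slots t w) => //; rewrite slotsS (h : _ = _).
  move: h; rewrite slotsS => /rcons_inj[yE xE].
  by split; [exact: esym|rewrite /preimage /mkset -yE].
rewrite (measure_countable Pt (fun y => mslots y tT)) esum_image; last first.
  by move=> y z _ _ /rcons_inj[].
have mB : measurable (slots t @^-1` B : set (filt E gap V T)).
  exact: (measurable_preimage_countable (Omega := filt E gap V T)).
rewrite -(setIT (slots t @^-1` B)) -(integral_indic Pt measurableT mB).
rewrite -ge0_integralZl//; last first.
  by apply/measurable_EFinP; exact: measurable_indic.
transitivity (\int[Pt]_w
    (fun o => ((tilted_law x)%:E * (\1_B o)%:E)%E) (slots t w))%E; last first.
  by apply: eq_integral => w _; rewrite !indicE.
rewrite (@integral_countable _ _ _ Pt _ (slots t) msl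
  (fun o => (tilted_law x)%:E * (\1_B o)%:E)%E) => [|y]; last first.
  by rewrite mule_ge0// lee_fin.
rewrite esum_mkcond; apply: eq_esum => y _; rewrite indicE.
case: ifPn => [yB|_]; last by rewrite mule0 mul0e.
rewrite mule1; have := tilted_slots (rcons y x) tT; have := tilted_slots y (ltnW tT).
rewrite size_rcons eqSS => h1 h2; rewrite [LHS]h2 [X in (_ * X)%E]h1.
case: ifP => _; last by rewrite mule0.
by rewrite -cats1 big_cat big_seq1/= mulrC EFinM.
Qed.

Lemma tilted_law_eq0 x : (slot_law lam Q x == 0) = (tilted_law x == 0).
Proof.
have hx : <<s history E gap V T >> (slotv 1 @^-1` [set x]) by exact: mslotv.
have := equiv hx; rewrite Pt_slotv1.
have -> : P (slotv 1 @^-1` [set x]) = (slot_law lam Q x)%:E.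
  exact: (prob_slotv1 mbp).
move=> [h1 h2]; apply/eqP/eqP => h.
  by have [] : (tilted_law x)%:E = 0%E by apply: h1; rewrite h.
by have [] : (slot_law lam Q x)%:E = 0%E by apply: h2; rewrite h.
Qed.

(** [lamt] is the probability of an occupied slot and [Qt] the law of its mark given occupation. By
    equivalence neither the empty nor the occupied slot is negligible, hence the strict bounds on
    [lamt]. *)
Lemma tilted_law_params : exists lamt (Qt : probability int R),
  [/\ 0 < lamt < 1, Qt E = 1%E & forall x, tilted_law x = slot_law lamt Qt x].
Proof.
have /andP[l0 l1] := lam01.
pose N : set (filt E gap V T) := slotv 1 @^-1` [set None].
have mN : measurable N by exact: mslotv.
pose D := ~` N; have mD : measurable D by exact: measurableC.
have p0 : 0 < tilted_law None.
  rewrite lt0r fine_ge0// andbT -tilted_law_eq0 /=.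
  by rewrite subr_eq0 eq_sym lt_eqF.
have PD : Pt D = (1 - tilted_law None)%:E.
  by rewrite probability_setC// EFinB -Pt_slotv1.
have PD0 : Pt D != 0%E.
  apply/eqP => /(equiv mD).2.
  have PN : P N = (1 - lam)%:E by exact: (prob_slotv1 mbp).
  rewrite (_ : P D = (1 - (1 - lam))%:E); last first.
    by rewrite probability_setC ?PN//; exact: (measurable_slotv mbp).
  by move=> h; have := EFin_inj h; lra.
have p1 : tilted_law None < 1.
  rewrite -subr_gt0 lt0r -lee_fin -PD measure_ge0 andbT.
  by apply: contraNneq PD0 => h; rewrite PD h.
(* The default mark 0 of an empty slot cannot be confused with a true mark 0, since [Qt] is
   conditioned on occupation. *)
pose f w := odflt 0 (slotv 1 w).
have mf : measurable_fun [set: filt E gap V T] f.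
  apply: (@measurable_comp_countable _ (filt E gap V T) _ (slotv 1) _ _ _ (odflt 0)).
  by move=> x; exact: mslotv.
have [Qt QtE] := conditional_law Q mf mD PD0.
exists (1 - tilted_law None), Qt; split; first by apply/andP; split; lra.
  rewrite QtE (_ : _ `&` _ = D).
    by rewrite PD /= -EFinM divff// gt_eqF// subr_gt0.
  apply/setIidr => w Dw; rewrite /preimage /mkset /f.
  case sw : (slotv 1 w) => [k|]; last by case: Dw.
  move/(slotv_Some V (gap_gt0 mbp)) : sw => [i [_ /= Vk]].
  by rewrite /= -Vk; exact: (mark_in mbp).
case=> [k|] /=; last by ring.
rewrite QtE PD (_ : _ `&` _ = slotv 1 @^-1` [set Some k]).
  rewrite Pt_slotv1 -EFinM /=; field.
  by rewrite gt_eqF// subr_gt0.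
apply/seteqP; split=> w.
  move=> [+ Dw]; rewrite /preimage /mkset /f.
  by case: (slotv 1 w) (Dw : slotv 1 w <> None) => [j|] //= _ ->.
by rewrite /preimage /mkset /f => h; split; [rewrite h|rewrite /D /N /preimage /= h].
Qed.

(** The quotient is 0 on marks of probability 0; this is consistent because [tilted_law] vanishes
    there as well, by [tilted_law_eq0]. *)
Definition likelihood x : R := tilted_law x / slot_law lam Q x.

Lemma likelihood_ge0 x : 0 <= likelihood x.
Proof.
by apply: divr_ge0; [exact: fine_ge0|exact: slot_law_ge0].
Qed.

Lemma likelihoodE x : likelihood x * slot_law lam Q x = tilted_law x.
Proof.
rewrite /likelihood; have [h|h] := eqVneq (slot_law lam Q x) 0.
  by apply/esym/eqP; rewrite h mulr0 -tilted_law_eq0 h.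
by rewrite divfK.
Qed.

Lemma integral_likelihood : (\int[P]_w (likelihood (slotv 1 w))%:E = 1)%E.
Proof.
have m1 x : measurable (slotv 1 @^-1` [set x]) by exact: (measurable_slotv mbp).
rewrite (@integral_countable _ _ _ P _ (slotv 1) m1 (fun x => (likelihood x)%:E)) => [|x];
  last by rewrite lee_fin likelihood_ge0.
transitivity (\esum_(x in [set: option int]) (1 * Pt (slotv 1 @^-1` [set x])))%E.
  apply: eq_esum => x _; rewrite [X in (_ * X)%E](prob_slotv1 mbp) -EFinM.
  by rewrite likelihoodE mul1e -Pt_slotv1.
rewrite -(@integral_countable _ _ _ Pt _ (slotv 1) (fun y => mslotv y T1) (fun=> 1%E)) => [|y];
  last by [].
rewrite integral_cst// mul1e; exact: probability_setT.
Qed.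

(** Both measures of an event are sums over the same words, and they agree word by word through
    [likelihoodE]. The version [F \o slots t] is exactly measurable for the filtration, while [L]
    only has to agree with it almost surely. *)
Lemma likelihood_density t (L : Omega -> R) : (0 < t <= T)%N ->
  {ae P, forall w, L w = \prod_(s < t) likelihood (slotv s.+1 w)} ->
  is_density P Pt t L.
Proof.
move=> /andP[t0 tT] LE; pose F o : R := \prod_(x <- o) likelihood x.
have FE w : F (slots t w) = \prod_(s < t) likelihood (slotv s.+1 w).
  have it : iota 0 t = index_iota 0 t by rewrite /index_iota subn0.
  by rewrite /F big_map it big_mkord.
have F0 o : 0 <= F o by apply: prodr_ge0 => x _; exact: likelihood_ge0.
exists (F \o slots t); split.
- apply: (@measurable_comp_countable _ (filt E gap V t) _ (slots t)) => o.
  exact: (measurable_slots_filt mbp).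
- by move=> w; exact: F0.
- by apply: filterS LE => w ->; rewrite /= FE.
move=> A At; have mA := history_measurable mbp At.
have mAT := measurable_history mbp tT At.
have [B AB] := history_slots mbp At.
have msl o : measurable (slots t @^-1` [set o]) by exact: (measurable_slots mbp).
rewrite integral_mkcond.
rewrite (eq_integral (fun w => (fun o => (\1_B o * F o)%:E) (slots t w))); last first.
  move=> w _; rewrite /patch indicE AB.
  have -> : (w \in slots t @^-1` B) = (slots t w \in B).
    by apply/idP/idP; rewrite !inE.
  by case: ifP; rewrite ?mul1r ?mul0r.
rewrite (@integral_countable _ _ _ P _ (slots t) msl (fun o => (\1_B o * F o)%:E)) => [|y].
  rewrite {1}AB (measure_countable Pt (fun y => mslots y tT)) esum_mkcond.
  apply: eq_esum => y _; rewrite indicE.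
  case: ifPn => _; last by rewrite mul0r mul0e.
  rewrite mul1r [LHS](tilted_slots y tT) [X in (_ = _ * X)%E](prob_slots mbp) -EFinM.
  case: ifP => _; last by rewrite mulr0.
  rewrite /F -big_split/=; congr EFin; apply: eq_bigr => x _.
  by rewrite likelihoodE.
by rewrite lee_fin mulr_ge0.
Qed.

End change_of_law.

Theorem theorem4p1 (d : measure_display) (Omega : measurableType d)
    (R : realType) (P : probability Omega R)
    (E : set int) (lam : R) (Q : probability int R)
    (gap : nat -> {RV P >-> nat}) (V : nat -> {RV P >-> int})
    (I : set nat) (e : nat -> int)
    (lam01 : 0 < lam < 1)
    (QE : Q E = 1%E) (Q_gt0 : forall k, E k -> (0 < Q [set k])%E)
    (mbp : marked_binomial lam E Q gap V)
    (enumE : enumerates E I e)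
    (T : nat) (T_gt0 : (0 < T)%N)
    (Pt : probability (filt E gap V T) R)
    (equiv : equivalent_on P Pt)
    (mbpt : iid_slots Pt) :
  exists (lamt : R) (Qt : probability int R),
    [/\ 0 < lamt < 1,
        Qt E = 1%E,
        is_compensator Pt (intensity lamt Qt) &
        let g := girsanov_kernel T lam Q lamt Qt in
        let J1 h := J P lam Q gap V I e (@tens _ h 1) in
        let J1g := J1Z P lam E Q gap V g in
        inL2 lam Q E g ->
        exists h : nat -> int -> R,
          [/\ inL2 lam Q E h,
              {ae P, forall w, J1 h w = J1g w},
              (forall h', inL2 lam Q E h' ->
                 {ae P, forall w, J1 h' w = J1g w} ->
                 forall t k, (0 < t)%N -> E k -> h' t k = h t k) &
              forall t, (0 < t <= T)%N ->
                is_density P Pt t (doleans_upto P lam Q gap V I e t h)]].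
Proof.
have [lamt [Qt [lamt01 QtE ptE]]] := tilted_law_params lam01 mbp T_gt0 equiv.
exists lamt, Qt; split=> //.
  move=> [//|t] k A tT Ek hA.
  rewrite (_ : Defs.point _ _ _ _ = slotv gap V t.+1 @^-1` [set Some k]).
    by rewrite (tilted_slot mbp T_gt0 mbpt)// ptE.
  exact: (slotE V (gap_gt0 mbp) t.+1 (Some k)).
move=> g J1 J1g g2.
pose L := likelihood lam Q Pt; pose G x := L x - 1.
(* The Girsanov kernel is the likelihood of a mark minus that of the empty slot. This shift makes
   [phi] vanish on the empty slot, as needed for a sum over points. *)
pose phi x := L x - L None.
have gE : g = fun t k => if (t <= T)%N then phi (Some k) else 0.
  apply/funext => t; apply/funext => k; rewrite /g /girsanov_kernel /phi /L.
  by rewrite /likelihood !ptE.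
(* Summability of [g] enters here; as [G] differs from [phi] by a constant, [G] is square integrable
   too. *)
have phi2 : L2 P (fun w => phi (slotv gap V 1 w)).
  by apply: (inL2_slot lam01 mbp T_gt0); [exact: subrr|rewrite -gE].
have Gphi x : G x = phi x + (L None - 1) by rewrite /G /phi; ring.
have G2 : L2 P (fun w => G (slotv gap V 1 w)).
  rewrite (_ : (fun w => _) = fun w => phi (slotv gap V 1 w) + (L None - 1)).
    by apply: L2D => //; exact: L2_cst.
  by apply/funext => w; exact: Gphi.
have LL1 : L1 P (fun w => L (slotv gap V 1 w)).
  rewrite (_ : (fun w => _) = fun w => G (slotv gap V 1 w) + 1).
    by apply: L1D; [exact: L2_L1|exact: L1_cst].
  by apply/funext => w; rewrite subrK.
have G0 : slot_mean gap V G = 0.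
  rewrite /slot_mean /G meanB//; last exact: L1_cst.
  rewrite mean_cst /mean (integral_likelihood lam01 mbp T_gt0 equiv).
  exact: subrr.
(* [phi] minus its mean is [G]: the constant [L None] cancels, so integrating [g] against the
   centered [dZ] yields the sum of [G] over the slots, like [J1 h]. *)
have phi_mean : slot_mean gap V phi = 1 - L None.
  rewrite /slot_mean.
  rewrite (_ : (fun w => phi _) = fun w => G (slotv gap V 1 w) + (1 - L None)).
    rewrite meanD; [|exact: L2_L1|exact: L1_cst].
    by rewrite mean_cst -[mean P _]/(slot_mean gap V G) G0 add0r.
  by apply/funext => w; rewrite Gphi; ring.
pose h := proj_kernel lam Q gap V I e G T.
have h_proj t j : (0 < t <= T)%N -> I j ->
    h t (e j) = proj_coef lam Q gap V I e G j.
  exact: (proj_kernelE lam Q gap V enumE G).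
have h_late t k : (T < t)%N -> h t k = 0 by exact: proj_kernel_late.
have J1hE : {ae P, forall w, J1 h w = \sum_(s < T) G (slotv gap V s.+1 w)}.
  have := J_elem_sym lam01 Q_gt0 mbp enumE G2 G0 h_proj h_late 1.
  by apply: filterS => w; rewrite /J1 => ->; rewrite mul1r elem_sym1E.
have J1gE : {ae P, forall w, J1g w = \sum_(s < T) G (slotv gap V s.+1 w)}.
  have X := J1Z_is_L2sum lam01 mbp enumE phi2 (subrr (L None)) T.
  have := is_L2sum_unique (J1Z_term_L2 mbp phi T) (is_L2sum_L2sum X) X.
  apply: filterS => w; rewrite /J1g /J1Z gE => ->.
  by apply: eq_bigr => s _; rewrite phi_mean Gphi; ring.
have J1hg : {ae P, forall w, J1 h w = J1g w}.
  by apply: filterS2 J1hE J1gE => w -> ->.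
exists h; split=> //.
- exact: inL2_proj_kernel.
- move=> h' h'2 J1h' t k t0 Ek; apply: (J1_inj lam01 Q_gt0 mbp enumE) => //.
    exact: inL2_proj_kernel.
  by apply: filterS2 J1h' J1hg => w J1h'w J1hw; exact: etrans J1h'w (esym J1hw).
move=> t /andP[t0 tT]; apply: (likelihood_density lam01 mbp T_gt0 equiv mbpt).
  by rewrite t0.
(* The kernel cut at [t] keeps its coefficients up to [t] and vanishes later, so the product formula
   holds with horizon [t]; each factor [1 + G] is the likelihood [L]. *)
have := doleans_prod lam01 Q_gt0 mbp enumE G2 G0 (T := t)
  (h := fun s k => if (s <= t)%N then h s k else 0).
case=> [s j /andP[s0 st] Ij|s k ts|B [mB B0 sB]].
- by rewrite st h_proj// s0 (leq_trans st).
- by rewrite leqNgt ts.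
exists B; split=> // w wB; apply: sB => /= wE; apply: wB.
rewrite /= /doleans_upto wE; apply: eq_bigr => s _.
by rewrite /G addrC subrK.
Qed.
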